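(* Let $\Omega\subset\mathbb{R}^d$ be an open set, let $E,F$ be finite dimensional euclidean spaces, let $P_0,P_1,\dots,P_d\in F\otimes E$ (regarded as linear maps $E\to F$), and let $P(D)$ be the first-order operator $P(D)\mu=\sum_{i=1}^d P_i[\partial_i\mu]+P_0\mu$. Let $\mu\in\mathcal{M}(\Omega;E)$ satisfy $P(D)\mu=0$ in the sense of distributions on $\Omega$. Then $$|\mu|\llcorner\Big\{x\in\Omega : \tfrac{\mathrm{d}\mu}{\mathrm{d}|\mu|}(x)\notin\Lambda_{\mathbb P}\Big\}\ \ll\ \mathcal{H}^\kappa\qquad\text{for all }0\le\kappa<d.$$
   Context: $\mathcal{M}(\Omega;E)$ denotes the space of $E$-valued (locally finite) Radon measures on $\Omega$, i.e. the dual of $C_c(\Omega;E)$; $|\mu|$ is the total variation measure of $\mu$ and $\frac{\mathrm{d}\mu}{\mathrm{d}|\mu|}$ its polar (Radon–Nikodym density). $\mathcal{H}^\kappa$ is the $\kappa$-dimensional Hausdorff measure on $\mathbb{R}^d$. The principal symbol of $P(D)$ is $\mathbb{P}(\xi):=\sum_{i=1}^d\xi_iP_i$, $\xi\in\mathbb{R}^d$, and the wave cone is $\Lambda_{\mathbb P}:=\bigcup_{\xi\in\mathbb{R}^d\setminus\{0\}}\ker\mathbb P(\xi)\subset E$. *)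

(* Defs.v *)
From HB Require Import structures.
From mathcomp Require Export all_boot all_order all_algebra.
From mathcomp Require Export all_classical all_reals all_analysis.
Export numFieldNormedType.Exports.

Set Implicit Arguments.
Unset Strict Implicit.
Unset Printing Implicit Defensive.
Import Order.TTheory GRing.Theory Num.Theory.

Local Open Scope classical_set_scope.
Local Open Scope ring_scope.

(* R^k is 'rV[R]_k.  The library norm `|x| on 'rV[R]_k is the sup norm, which
   gives the usual topology but not the Euclidean length, hence [enorm]. *)
Definition dotp (R : realType) (k : nat) (u v : 'rV[R]_k) : R :=
  \sum_(i < k) u 0 i * v 0 i.

Definition enorm (R : realType) (k : nat) (v : 'rV[R]_k) : R :=
  Num.sqrt (dotp v v).

Definition borel (R : realType) (k : nat) :=
  g_sigma_algebraType (@open 'rV[R]_k).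

(* C_c(U; R^m). *)
Definition Cc (R : realType) (d m : nat) (U : set 'rV[R]_d)
    (phi : 'rV[R]_d -> 'rV[R]_m) : Prop :=
  let supp := closure [set x | phi x != 0] in
  [/\ continuous phi, compact supp & supp `<=` U].

Definition partial (R : realType) (d n : nat) (i : 'I_d)
    (f : 'rV[R]_d -> 'rV[R]_n) : 'rV[R]_d -> 'rV[R]_n :=
  fun x => 'D_(delta_mx 0 i) f x.

Definition partials (R : realType) (d n : nat) (s : seq 'I_d)
    (f : 'rV[R]_d -> 'rV[R]_n) : 'rV[R]_d -> 'rV[R]_n :=
  foldr (@partial R d n) f s.

(* C^oo: partial derivatives of every order exist and are continuous. *)
Definition smooth (R : realType) (d n : nat) (f : 'rV[R]_d -> 'rV[R]_n) : Prop :=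
  forall s : seq 'I_d, continuous (partials s f) /\
    forall (i : 'I_d) (x : 'rV[R]_d), derivable (partials s f) x (delta_mx 0 i).

(* M(Omega; R^m) as the dual of C_c(Omega; R^m) with its inductive limit
   topology.  The values of the functional outside C_c(Omega; R^m) are
   unspecified and never used. *)
Record radon (R : realType) (d m : nat) (Omega : set 'rV[R]_d) := Radon {
  pairing :> ('rV[R]_d -> 'rV[R]_m) -> R ;
  pairing_linear : forall (a : R) (phi psi : 'rV[R]_d -> 'rV[R]_m),
    Cc Omega phi -> Cc Omega psi ->
    pairing (fun x => a *: phi x + psi x) = a * pairing phi + pairing psi ;
  pairing_bounded : forall K : set 'rV[R]_d, compact K -> K `<=` Omega ->
    exists C : R, forall phi : 'rV[R]_d -> 'rV[R]_m, Cc Omega phi ->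
      (forall x, ~ K x -> phi x = 0) ->
      forall c : R, (forall x, enorm (phi x) <= c) -> `|pairing phi| <= C * c
}.

(* |mu|(U) for U open in Omega. *)
Definition tv_open (R : realType) (d m : nat) (Omega : set 'rV[R]_d)
    (mu : radon m Omega) (U : set 'rV[R]_d) : \bar R :=
  ereal_sup [set (mu phi)%:E | phi in
    [set phi | Cc U phi /\ forall x, enorm (phi x) <= 1]].

Definition tv (R : realType) (d m : nat) (Omega : set 'rV[R]_d)
    (mu : radon m Omega) (B : set 'rV[R]_d) : \bar R :=
  ereal_inf [set tv_open mu U | U in
    [set U | [/\ open U, B `<=` U & U `<=` Omega]]].

(* [nu] is |mu|, seen as a Borel measure on R^d vanishing outside Omega.  By
   the Riesz representation theorem there is exactly one such measure on
   Borel sets when Omega is open. *)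
Definition is_total_variation (R : realType) (d m : nat)
    (Omega : set 'rV[R]_d) (mu : radon m Omega)
    (nu : {measure set (borel R d) -> \bar R}) : Prop :=
  forall B : set (borel R d), measurable B -> nu B = tv mu (B `&` Omega).

(* [sigma] represents d mu / d|mu|: mu = sigma |mu| with |sigma| = 1
   |mu|-almost everywhere; it is unique up to |mu|-null sets. *)
Definition is_polar (R : realType) (d m : nat)
    (Omega : set 'rV[R]_d) (mu : radon m Omega)
    (nu : {measure set (borel R d) -> \bar R})
    (sigma : borel R d -> borel R m) : Prop :=
  [/\ measurable_fun (Omega : set (borel R d)) sigma,
      {ae nu, forall x, Omega x -> enorm (sigma x) = 1} &
      forall phi : 'rV[R]_d -> 'rV[R]_m, Cc Omega phi ->
        (mu phi)%:E = (\int[nu]_(x in (Omega : set (borel R d))) (dotp (phi x) (sigma x))%:E)%E].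

(* A linear map R^m -> R^n is a matrix M : 'M[R]_(m, n) acting on row vectors
   by v |-> v *m M; its adjoint is w |-> w *m M^T. *)
Definition symbol (R : realType) (d m n : nat) (P : 'I_d -> 'M[R]_(m, n))
    (xi : 'rV[R]_d) : 'M[R]_(m, n) :=
  \sum_(i < d) xi 0 i *: P i.

Definition wave_cone (R : realType) (d m n : nat) (P : 'I_d -> 'M[R]_(m, n)) :
    set 'rV[R]_m :=
  \bigcup_(xi in [set xi : 'rV[R]_d | xi != 0])
    [set v | v *m symbol P xi = 0].

(* P(D) mu = sum_i P_i [d_i mu] + P_0 mu = 0 in D'(Omega; R^n):
   < P(D) mu, psi > = < mu, - sum_i P_i^T (d_i psi) + P_0^T psi >. *)
Definition solves (R : realType) (d m n : nat) (Omega : set 'rV[R]_d)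
    (P0 : 'M[R]_(m, n)) (P : 'I_d -> 'M[R]_(m, n)) (mu : radon m Omega) : Prop :=
  forall psi : 'rV[R]_d -> 'rV[R]_n, smooth psi -> Cc Omega psi ->
    mu (fun x => - (\sum_(i < d) partial i psi x *m (P i)^T)
                 + psi x *m P0^T) = 0.

(* diam set0 is -oo; [hausdorff_gauge] treats set0 separately. *)
Definition diam (R : realType) (d : nat) (A : set 'rV[R]_d) : \bar R :=
  ereal_sup [set (enorm (x - y))%:E | x in A & y in A].

(* diam(A)^kappa, with diam(A)^0 = 1 for nonempty A. *)
Definition hausdorff_gauge (R : realType) (d : nat) (kappa : R)
    (A : set 'rV[R]_d) : \bar R :=
  if A == set0 then 0%E else poweR (diam A) kappa.

Definition hausdorff_pre (R : realType) (d : nat) (kappa delta : R)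
    (A : set 'rV[R]_d) : \bar R :=
  ereal_inf [set (\sum_(0 <= k <oo) hausdorff_gauge kappa (C k))%E | C in
    [set C : nat -> set 'rV[R]_d |
      A `<=` \bigcup_k C k /\ forall k, (diam (C k) <= delta%:E)%E]].

(* The Hausdorff measure H^kappa, without the normalising factor
   pi^(kappa/2) / (2^kappa Gamma(kappa/2 + 1)), which does not affect null
   sets. *)
Definition hausdorff (R : realType) (d : nat) (kappa : R)
    (A : set (borel R d)) : \bar R :=
  ereal_sup [set hausdorff_pre kappa delta A | delta in [set delta : R | 0 < delta]].

(* Main.v *)
Require Import Defs.
From mathcomp Require Import measurable_realfun ring lra.
Import Order.TTheory GRing.Theory Num.Theory.
Set Implicit Arguments.
Unset Strict Implicit.
Unset Printing Implicit Defensive.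
Local Open Scope classical_set_scope.
Local Open Scope ring_scope.

(** Let [M v] be the d x n matrix with rows [v *m P i].  Since
    [v *m symbol P xi = xi *m M v], the vector [v] lies outside the wave cone
    exactly when the rows of [M v] are independent, i.e. when [M v *m W = 1]
    for some [W].  Fix [W] and let [G] be the set where [M (sigma x) *m W] is
    close to the identity.  For a vector field [u] with compact support, the
    equation tested against [u W^T] says that the integral of div u against
    |mu| is an error, which is small where the measure lives on [G]
    ([weak_form]).  So on [G] the measure |mu| behaves like a measure with
    vanishing gradient, i.e. like Lebesgue measure, and its lower dimension
    should be d.

    This is made quantitative without blow-ups by a single choice of [u].  For
    [0 < kappa < d], let [k_a x = (a + |x - c|^2)^(- kappa / 2)] and
    [u x = chi x (x - c) k_a x] with a cutoff [chi].  Then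
    [div ((x - c) k_a) >= (d - kappa) k_a], while every derivative of
    [(x - c) k_a] is at most [(1 + kappa) k_a]; hence the equation yields
    ([energy_bound])

      (d - kappa) / 4 * \int_Q k_a d|mu| <= C \int_(Q \ G) k_a d|mu| + M

    on small cubes [Q] about [c], with [M] independent of [a].

    At |mu|-almost every point of [G] the integral over [Q \ G] can be absorbed.
    Vitali's covering argument and outer regularity show that for small [s] the
    measure of [Q_s \ G] is at most [1 / T] times the measure of [Q_(3 s)], for
    any prescribed [T] ([weak_density]).  Comparing a cube with its enlargement
    costs a constant factor, as [k_a] decays polynomially: it is comparable to the
    sum of [s^-kappa] over the cubes [Q_s], [s = 3^-j], that contain the point
    ([riesz_le_staircase], [staircase_le_riesz]).  Therefore \int_Q k_a stays
    bounded as [a] tends to 0, and with [a = s^2] this gives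
    [|mu|(Q_s(c)) <= L s^kappa] for all small [s] ([density_bound]).

    A set on which such a bound holds with one constant has measure zero as soon
    as it is null for the Hausdorff measure of some dimension at most [kappa]
    ([hausdorff_null_cover]).  Countably many [W] (those with rational entries)
    and countably many cubes reach every point whose polar is outside the wave
    cone ([notin_cone_approx], [rat_cube]). *)

(** * Functions of class C^k *)

Section directional.
Context {R : realType} {V : normedModType R}.

(** Reduces directional derivatives to derivatives of one real variable, so that
    the one-dimensional chain rule applies to functions that are not assumed
    differentiable. *)
Lemma is_derive_line (f : V -> R) (x v : V) (a : R) :
  is_derive x v f a <-> is_derive (0 : R) 1 (fun h : R => f (h *: v + x)) a.
Proof.
have E : 'D_1 (fun h : R => f (h *: v + x)) 0 = 'D_v f x.
  rewrite /derive.
  set g1 := fun h => h^-1 *: _; set g2 := fun h => h^-1 *: _.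
  suff -> : g1 = g2 by []; apply/funext => h; rewrite /g1 /g2 /=.
  by rewrite addr0 scale0r add0r [_%:A]mulr1.
have [D1 D2] := derivable1P f x v.
by split => -[df dE]; split; rewrite ?E -?dE//; [exact: D1|exact: D2].
Qed.

Lemma is_derive_comp1 (f : V -> R) (h : R -> R) (x v : V) (a b : R) :
  is_derive (f x) 1 h b -> is_derive x v f a -> is_derive x v (h \o f) (b * a).
Proof.
move=> dh /is_derive_line df; apply/is_derive_line.
apply: (@is_derive1_comp _ h (fun t : R => f (t *: v + x))) => //.
by rewrite scale0r add0r.
Qed.

End directional.

Section Ck.
Context {R : realType} {d : nat}.
Local Notation V := 'rV[R]_d.
Local Notation e_ i := (delta_mx 0 i : V).
Implicit Types f g : V -> R.

(** Only the partial derivatives are required to exist.  The innermost derivative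
    is taken first, so that products and compositions are handled by induction on
    [k] with the functions generalized. *)
Fixpoint Ck (k : nat) f : Prop :=
  continuous f /\
  if k is k'.+1 then forall i, (forall x, derivable f x (e_ i)) /\
    Ck k' (fun x => 'D_(e_ i) f x)
  else True.

Lemma Ck_continuous k f : Ck k f -> continuous f.
Proof. by case: k => [|k] []. Qed.

Lemma CkS k f : Ck k.+1 f -> Ck k f.
Proof.
elim: k f => [|k IH] f; first by move=> [].
move=> [cf df]; split => // i; have [? ?] := df i.
by split => //; exact: IH.
Qed.

Lemma Ck_derive k f (g : 'I_d -> V -> R) : continuous f ->
  (forall i x, is_derive x (e_ i) f (g i x)) -> (forall i, Ck k (g i)) ->
  Ck k.+1 f.
Proof.
move=> cf df Cg; split => // i; split; first by move=> x; have [] := df i x.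
rewrite (_ : (fun x => _) = g i)//; apply/funext => x.
by have [_] := df i x.
Qed.

Lemma Ck_is_derive k f : Ck k.+1 f ->
  forall i x, is_derive x (e_ i) f ('D_(e_ i) f x).
Proof. by move=> [_ +] i x => /(_ i)[+ _] => /(_ x) /derivableP. Qed.

Lemma Ck_cst k (c : R) : Ck k (fun=> c).
Proof.
elim: k c => [|k IH] c; first by split => // x; exact: cst_continuous.
apply: (Ck_derive (g := fun=> fun=> 0)) => //; first by move=> x; exact: cst_continuous.
Qed.

Lemma Ck_add k f g : Ck k f -> Ck k g -> Ck k (fun x => f x + g x).
Proof.
elim: k f g => [|k IH] f g Cf Cg.
  split => // x; apply: continuousD; [exact: Ck_continuous Cf _|exact: Ck_continuous Cg _].
apply: (Ck_derive (g := fun i x => 'D_(e_ i) f x + 'D_(e_ i) g x)).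
- by move=> x; apply: continuousD; [exact: Ck_continuous Cf _|exact: Ck_continuous Cg _].
- by move=> i x; apply: is_deriveD; [exact: (Ck_is_derive Cf)|exact: (Ck_is_derive Cg)].
- by move=> i; apply: IH; [exact: (Cf.2 i).2|exact: (Cg.2 i).2].
Qed.

Lemma Ck_mul k f g : Ck k f -> Ck k g -> Ck k (fun x => f x * g x).
Proof.
elim: k f g => [|k IH] f g Cf Cg.
  split => // x; apply: continuousM; [exact: Ck_continuous Cf _|exact: Ck_continuous Cg _].
apply: (Ck_derive (g := fun i x => f x * 'D_(e_ i) g x + g x * 'D_(e_ i) f x)).
- by move=> x; apply: continuousM; [exact: Ck_continuous Cf _|exact: Ck_continuous Cg _].
- by move=> i x; apply: is_deriveM; [exact: (Ck_is_derive Cf)|exact: (Ck_is_derive Cg)].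
- by move=> i; apply: Ck_add; apply: IH;
   [exact: CkS|exact: (Cg.2 i).2|exact: CkS|exact: (Cf.2 i).2].
Qed.

Lemma Ck_sum k (I : Type) (s : seq I) (f : I -> V -> R) :
  (forall i, Ck k (f i)) -> Ck k (fun x => \sum_(i <- s) f i x).
Proof.
move=> Cf; elim: s => [|i s IH].
  by under eq_fun do rewrite big_nil; exact: Ck_cst.
by under eq_fun do rewrite big_cons; exact: Ck_add.
Qed.

Lemma is_derive_coord (i j : 'I_d) (x : V) :
  is_derive x (e_ i) (fun y : V => y 0 j) ((i == j)%:R).
Proof.
apply/is_derive_line.
have -> : (fun h : R => (h *: e_ i + x) 0 j) =
          (fun h : R => h * (i == j)%:R + x 0 j).
  by apply/funext => h; rewrite !mxE eqxx/= eq_sym.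
apply: is_derive_eq.
by rewrite scaler0 add0r addr0 [_%:A]mulr1.
Qed.

Lemma Ck_coord k j : Ck k (fun x : V => x 0 j).
Proof.
case: k => [|k]; first by split => //; exact: coord_continuous.
apply: (Ck_derive (g := fun i _ => (i == j)%:R)).
- exact: coord_continuous.
- by move=> i x; exact: is_derive_coord.
- by move=> i; exact: Ck_cst.
Qed.

(** The outer function comes with a family closed under derivation ([h i] has
    derivative [h (s i)]); real powers and the flat functions below are such
    families, none of which is stable under derivation by itself. *)
Lemma Ck_comp k (I : Type) (h : I -> R -> R) (s : I -> I) (D : set R) f :
  (forall i t, D t -> is_derive t 1 (h i) (h (s i) t)) ->
  (forall x, D (f x)) -> Ck k f -> forall i, Ck k (h i \o f).
Proof.
move=> dh Df Cf.
have cont i : continuous (h i \o f).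
  move=> x; apply: continuous_comp; first exact: (Ck_continuous Cf).
  apply/differentiable_continuous/derivable1_diffP.
  by have [] := dh i _ (Df x).
elim: k Cf => [|k IH] Cf i; first by split.
apply: (Ck_derive (g := fun j x => h (s i) (f x) * 'D_(e_ j) f x)) => //.
- move=> j x; apply: is_derive_comp1; first exact: dh.
  exact: (Ck_is_derive Cf).
- move=> j; apply: Ck_mul; first by apply: IH; exact: CkS.
  exact: (Cf.2 j).2.
Qed.

Lemma is_derive_powR_cst (c p t : R) : 0 < t ->
  is_derive t 1 (fun t => c * t `^ p) (c * p * t `^ (p - 1)).
Proof.
move=> t0; have := is_derive1_powR p t0.
move=> ?; apply: is_derive_eq.
by rewrite /GRing.scale/= mulrA.
Qed.

Lemma Ck_powR k p f : (forall x, 0 < f x) -> Ck k f -> Ck k (fun x => f x `^ p).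
Proof.
move=> f0 Cf.
have -> : (fun x => f x `^ p) = (fun t => 1 * t `^ p) \o f.
  by apply/funext => x /=; rewrite mul1r.
apply: (@Ck_comp k (R * R) (fun cp t => cp.1 * t `^ cp.2)
  (fun cp => (cp.1 * cp.2, cp.2 - 1)) [set t | 0 < t] f _ _ Cf (1, p)) => //.
by move=> cp t t0 /=; exact: is_derive_powR_cst.
Qed.

End Ck.

Section vector_valued.
Context {R : realType} {d n : nat}.
Local Notation V := 'rV[R]_d.
Local Notation e_ i := (delta_mx 0 i : V).

Lemma continuous_row (T : topologicalType) (f : T -> 'rV[R]_n) :
  (forall j, continuous (fun x => f x 0 j)) -> continuous f.
Proof.
move=> cf x; apply/cvgrPdist_le => /= e e0; near=> y.
rewrite [leLHS]/Num.Def.normr/= mx_normrE (bigmax_le _ (ltW e0))//= => i _.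
rewrite !mxE ord1; move: i; near: y.
pose P (ij : 'I_1 * 'I_n) (y : T) := `|f x 0 ij.2 - f y 0 ij.2| <= e.
suff : \forall y \near x, forall ij, P ij y.
  by apply: filterS => y Py i; exact: Py i.
apply: filter_forall => -[i j].
exact: ((cvgrPdist_le _ _).1 (cf j x) _ e0).
Unshelve. all: by end_near. Qed.

Lemma partialE (f : V -> 'rV[R]_n) (i : 'I_d) (x : V) (j : 'I_n) :
  (forall j, derivable (fun y => f y 0 j) x (e_ i)) ->
  partial i f x 0 j = 'D_(e_ i) (fun y => f y 0 j) x.
Proof.
move=> df; rewrite /partial derive_mx ?mxE//.
by apply/derivable_mxP => a b; rewrite (ord1 a).
Qed.

(** [partials] applies the last entry of the list first, which is why the
    induction is on the end of the list. *)
Lemma smooth_Ck (f : V -> 'rV[R]_n) :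
  (forall k j, Ck k (fun x => f x 0 j)) -> smooth f.
Proof.
move=> Cf s; elim/last_ind: s f Cf => [|s i IH] f Cf.
  split => /=.
    by apply: continuous_row => j; have := Ck_continuous (Cf 0 j).
  by move=> i x; apply/derivable_mxP => a b; rewrite (ord1 a); exact: ((Cf 1 b).2 i).1.
rewrite /partials foldr_rcons; apply: IH => k j.
rewrite (_ : (fun x => _) = (fun x => 'D_(e_ i) (fun y => f y 0 j) x)).
  exact: ((Cf k.+1 j).2 i).2.
by apply/funext => x; apply: partialE => l; exact: ((Cf 1 l).2 i).1.
Qed.

End vector_valued.

(** * Cutoffs and radial kernels *)

Section bump.
Context {R : realType}.

(** The functions P(1/t) exp(-1/t) for t > 0, extended by 0, form a family closed
    under derivation; [flat 1] is the usual smooth function flat at 0. *)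
Definition flat (P : {poly R}) (t : R) : R :=
  if 0 < t then P.[t^-1] * expR (- t^-1) else 0.

(** Applied at u = 1/t, this is what makes every [flat P] vanish at 0 to all
    orders. *)
Lemma poly_le_expR (P : {poly R}) :
  exists2 C : R, 0 <= C & forall u, 0 <= u -> `|P.[u]| <= C * expR u.
Proof.
have monom n (u : R) : 0 <= u -> u ^+ n <= n`!%:R * expR u.
  case: n => [|n] u0; first by rewrite expr0 mul1r; rewrite -[leLHS]expR0 ler_expR.
  rewrite mulrC -ler_pdivrMr ?ltr0n ?fact_gt0//.
  by apply: le_trans (expR_ge1Dxn n u0); rewrite lerDr.
exists (\sum_(i < size P) `|P`_i| * i`!%:R); first by apply: sumr_ge0 => i _; exact: mulr_ge0.
move=> u u0; rewrite horner_coef mulr_suml; apply: le_trans (ler_norm_sum _ _ _) _.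
apply: ler_sum => i _; rewrite normrM -mulrA ler_wpM2l//.
by rewrite ger0_norm ?exprn_ge0//; exact: monom.
Qed.

(** At 0 the difference quotient P(1/t) exp(-1/t) / t is bounded by a multiple of
    t, by [poly_le_expR] applied to ['X^2 * P]. *)
Lemma is_derive_flat (P : {poly R}) (t : R) :
  is_derive t 1 (flat P) (flat ('X^2 * (P - P^`())) t).
Proof.
have [t0|t0|<-] := ltgtP 0 t.
- apply: (@near_eq_is_derive _ _ _ (fun t : R => P.[t^-1] * expR (- t^-1))).
    by near=> s; rewrite /flat ifT//; near: s; exact: lt_nbhsr.
  have tn0 : t != 0 by rewrite gt_eqF.
  have dV : is_derive t 1 (fun t : R => t^-1) (- t ^- 2).
    by have := @is_deriveV _ (fun t : R => t) t 1 1 tn0 (is_derive_id _ _); rewrite [_%:A]mulr1.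
  have dP : is_derive t 1 (fun t : R => P.[t^-1]) (P^`().[t^-1] * - t ^- 2).
    by apply: (@is_derive1_comp _ (horner P) (fun t : R => t^-1)).
  have dE : is_derive t 1 (fun t : R => expR (- t^-1)) (expR (- t^-1) * t ^- 2).
    apply: (@is_derive1_comp _ expR (fun t : R => - t^-1)).
    by have := is_deriveN dV; rewrite opprK.
  apply: (@is_derive_eq _ _ _ _ _ _ _ _ (is_deriveM dP dE)).
  have K (p p' e u : R) : p * (e * u) + e * (p' * - u) = u * (p - p') * e by ring.
  by rewrite /flat t0 hornerM hornerD hornerN hornerXn -exprVn; exact: K.
- apply: (@near_eq_is_derive _ _ _ (fun _ : R => 0 : R)).
    by near=> s; rewrite /flat ifF//; apply/negbTE; rewrite -leNgt ltW//;
      near: s; exact: lt_nbhsl.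
  by rewrite /flat ltNge ltW//=; exact: is_derive_cst.
- rewrite {2}/flat ltxx.
  have H : (fun h : R => h^-1 *: ((flat P \o shift 0) (h *: 1) - flat P 0)) @ 0^' --> (0:R).
    have [C C0 HC] := poly_le_expR ('X^2 * P).
    apply/cvgrPdist_le => /= e e0.
    near=> h; rewrite sub0r normrN addr0 [h%:A]mulr1 {2}/flat ltxx subr0.
    rewrite /flat; case: ifPn => h0; last by rewrite scaler0 normr0 ltW.
    rewrite /GRing.scale/= expRN.
    have hV : 0 <= h^-1 by rewrite invr_ge0 ltW.
    have := HC _ hV; rewrite hornerM hornerXn !normrM (ger0_norm hV).
    rewrite normfV (ger0_norm (expR_ge0 _)) => HP.
    have -> : h^-1 * (`|P.[h^-1]| * (expR h^-1)^-1) =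
       (h^-1 * h^-1 * `|P.[h^-1]|) / expR h^-1 * h.
      by field; rewrite !gt_eqF ?expR_gt0.
    have : h^-1 * h^-1 * `|P.[h^-1]| / expR h^-1 <= C.
      by rewrite ler_pdivrMr ?expR_gt0.
    move=> /(ler_wpM2r (ltW h0)) /le_trans; apply.
    have hC : h <= e / (C + 1).
      apply: le_trans (ler_norm _) _; near: h; apply: dnbhs0_le; rewrite divr_gt0//; lra.
    have : C * h <= C * (e / (C + 1)) by rewrite ler_wpM2l.
    move=> /le_trans; apply.
    rewrite mulrCA ler_piMr// ?(ltW e0)// ler_pdivrMr; lra.
  split; first by apply/cvg_ex; exists 0.
  exact: cvg_lim H.
Unshelve. all: by end_near. Qed.

End bump.

Section radial.
Context {R : realType} {d : nat}.
Local Notation V := 'rV[R]_d.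
Local Notation e_ i := (delta_mx 0 i : V).
Variable c : V.

(** The squared Euclidean distance: unlike the norm of ['rV_d], which is a
    maximum, it is smooth. *)
Definition dist2 (x : V) : R := \sum_(j < d) (x 0 j - c 0 j) ^+ 2.

Lemma dist2_ge0 x : 0 <= dist2 x.
Proof. by apply: sumr_ge0 => j _; exact: sqr_ge0. Qed.

Lemma coord_le_dist2 (x : V) j : (x 0 j - c 0 j) ^+ 2 <= dist2 x.
Proof. by rewrite /dist2 (bigD1 j)//= lerDl sumr_ge0 // => i _; exact: sqr_ge0. Qed.

Lemma dist2_center : dist2 c = 0.
Proof. by rewrite /dist2 big1// => j _; rewrite subrr expr0n. Qed.

Lemma Ck_shift k j : Ck k (fun x : V => x 0 j - c 0 j).
Proof. by apply: Ck_add; [exact: Ck_coord|exact: Ck_cst]. Qed.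

Lemma Ck_dist2 k : Ck k dist2.
Proof. by apply: Ck_sum => j; apply: Ck_mul; exact: Ck_shift. Qed.

Lemma is_derive_shift_coord i j (x : V) :
  is_derive x (e_ i) (fun y : V => y 0 j - c 0 j) (i == j)%:R.
Proof.
have H := is_derive_coord i j x.
by apply: (@is_derive_eq _ _ _ _ _ _ _ _ (is_deriveB H (is_derive_cst (c 0 j) x _))); rewrite subr0.
Qed.

Lemma is_derive_dist2 i (x : V) : is_derive x (e_ i) dist2 (2 * (x 0 i - c 0 i)).
Proof.
have -> : dist2 = \sum_(j < d) (fun y : V => (y 0 j - c 0 j) ^+ 2).
  by apply/funext => y; rewrite fct_sumE.
have H j : is_derive x (e_ i) (fun y : V => (y 0 j - c 0 j) ^+ 2)
    ((i == j)%:R * (2 * (x 0 i - c 0 i))).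
  have H := is_derive_shift_coord i j x.
  apply: (@is_derive_eq _ _ _ _ _ _ _ _ (is_deriveM H H)).
  by case: eqVneq => [->|_]; rewrite /GRing.scale/=; ring.
apply: (@is_derive_eq _ _ _ _ _ _ _ _ (is_derive_sum H)).
rewrite (bigD1 i)//= eqxx mul1r big1 ?addr0// => j ji.
by rewrite eq_sym (negbTE ji) mul0r.
Qed.

Variable a : R.
Hypothesis a_gt0 : 0 < a.

(** A Riesz kernel |x - c|^(2p) regularized at scale [a], to be smooth at [c]. *)
Definition riesz (p : R) (x : V) : R := (a + dist2 x) `^ p.

Lemma riesz_base_gt0 x : 0 < a + dist2 x.
Proof. by rewrite ltr_wpDr// dist2_ge0. Qed.

Lemma Ck_riesz k p : Ck k (riesz p).
Proof.
apply: Ck_powR; first exact: riesz_base_gt0.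
by apply: Ck_add; [exact: Ck_cst|exact: Ck_dist2].
Qed.

Lemma is_derive_riesz p i (x : V) :
  is_derive x (e_ i) (riesz p) (2 * p * (x 0 i - c 0 i) * riesz (p - 1) x).
Proof.
have H : is_derive x (e_ i) (fun y => a + dist2 y) (2 * (x 0 i - c 0 i)).
  apply: (@is_derive_eq _ _ _ _ _ _ _ _
    (is_deriveD (is_derive_cst a x _) (is_derive_dist2 i x))).
  by rewrite add0r.
have -> : riesz p = (fun t : R => t `^ p) \o (fun y => a + dist2 y) by [].
have -> : 2 * p * (x 0 i - c 0 i) * riesz (p - 1) x =
    p * (a + dist2 x) `^ (p - 1) * (2 * (x 0 i - c 0 i)) by rewrite /riesz; ring.
by apply: is_derive_comp1 => //; exact/is_derive1_powR/riesz_base_gt0.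
Qed.

End radial.

Section cutoff.
Context {R : realType} {d : nat}.
Local Notation V := 'rV[R]_d.

Lemma Ck_flat k (P : {poly R}) (f : V -> R) :
  Ck k f -> Ck k (fun x => flat P (f x)).
Proof.
move=> Cf; apply: (@Ck_comp _ _ k {poly R} flat
  (fun P => 'X^2 * (P - P^`())) setT f _ _ Cf P) => //.
by move=> Q t _; exact: is_derive_flat.
Qed.

(** [flat 1 (r - |x - c|^2)], normalized at [c]. *)
Lemma smooth_cutoff (c : V) (r : R) : 0 < r ->
  exists chi : V -> R, [/\ forall k, Ck k chi, forall x, 0 <= chi x <= 1,
    chi c = 1 & forall x, chi x != 0 -> dist2 c x < r].
Proof.
move=> r0; pose N := flat 1 r.
have flat1 t : 0 < t -> flat 1 t = expR (- t^-1) by move=> t0; rewrite /flat t0 hornerC mul1r.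
have N0 : 0 < N by rewrite /N flat1// expR_gt0.
exists (fun x => flat 1 (r + - 1 * dist2 c x) * N^-1); split.
- move=> k; apply: Ck_mul; last exact: Ck_cst.
  apply: Ck_flat; apply: Ck_add; first exact: Ck_cst.
  by apply: Ck_mul; [exact: Ck_cst|exact: Ck_dist2].
- move=> x; have [D0|D0] := ltP 0 (r + -1 * dist2 c x); last first.
    by rewrite {1 2}/flat ltNge D0/= mul0r lexx ler01.
  rewrite flat1//; apply/andP; split.
    by apply: divr_ge0; [exact: expR_ge0|exact: ltW].
  rewrite ler_pdivrMr// mul1r /N flat1// ler_expR.
  rewrite lerN2 lef_pV2 ?posrE//.
  by have := dist2_ge0 c x; lra.
- by rewrite dist2_center mulr0 addr0 mulfV// gt_eqF.
- move=> x; apply: contraNT; rewrite -leNgt => rx.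
  by rewrite /flat ltNge (_ : _ <= 0) ?mul0r//; lra.
Qed.

End cutoff.

(** * Borel sets and cubes *)

Section borel.
Context {R : realType} {d : nat}.
Local Notation V := 'rV[R]_d.

Lemma borel_open (U : set V) : open U -> measurable (U : set (borel R d)).
Proof. by move=> oU; exact: sub_sigma_algebra. Qed.

Lemma borel_closed (U : set V) : closed U -> measurable (U : set (borel R d)).
Proof.
move=> cU; rewrite -[U]setCK; apply: measurableC; apply: borel_open.
exact: closed_openC.
Qed.

Lemma borel_continuous (f : V -> R) (D : set (borel R d)) :
  continuous f -> measurable D -> measurable_fun D (f : borel R d -> R).
Proof.
move=> cf mD; apply: (measurability _ (measurable_realfun.RGenOpens.measurableE R)).
move=> _ [_ [a [b ->]] <-]; apply: measurableI => //.
apply: borel_open; apply: open_comp; last exact: interval_open.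
by move=> x _; exact: cf.
Qed.

(** Balls of the norm of ['rV_d]; closed, so that they are compact. *)
Definition cube (c : V) (r : R) : set V := [set x | `|c - x| <= r].

Lemma closed_cube c r : closed (cube c r).
Proof. exact: closed_closed_ball_. Qed.

Lemma measurable_cube c r : measurable (cube c r : set (borel R d)).
Proof. by apply: borel_closed; exact: closed_cube. Qed.

Lemma compact_cube c r : compact (cube c r).
Proof.
apply: bounded_closed_compact; last exact: closed_cube.
exists (`|c| + r); split; first exact: num_real.
move=> M rM x cx; rewrite -[x](subrK c); apply: le_trans (ler_normD _ _) _.
by rewrite addrC; apply: le_trans (ltW rM); rewrite lerD2l distrC.
Qed.

Lemma cubeS c r s : r <= s -> cube c r `<=` cube c s.
Proof. by move=> rs x cx; exact: le_trans cx rs. Qed.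

Lemma cube_coord c r x : 0 <= r -> cube c r x <-> forall j, `|x 0 j - c 0 j| <= r.
Proof.
move=> r0; rewrite /cube/= {1}/Num.Def.normr/= mx_normrE; split.
  move=> /bigmax_leP[_ H] j; have := H (0, j) isT; rewrite !mxE/=.
  by rewrite distrC.
by move=> H; apply/bigmax_leP; split => //= -[i j] _; rewrite !mxE ord1 distrC; exact: H.
Qed.

End borel.

Lemma compact_norm_bound (R : realType) (d : nat) (K : set 'rV[R]_d)
    (f : 'rV[R]_d -> R) : compact K -> continuous f ->
  exists2 M : R, 0 <= M & forall x, K x -> `|f x| <= M.
Proof.
move=> cK cf; have [->|/set0P K0] := eqVneq K set0.
  by exists 0 => // x [].
have [|c _ Hc] := @EVT_max_rV _ _ (fun x => `|f x|) K K0 cK.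
  by apply: continuous_subspaceT => x; apply: continuous_comp;
    [exact: cf|exact: norm_continuous].
by exists `|f c| => // x Kx; apply: Hc; exact: mem_set.
Qed.

Lemma norm_row_mul_le (R : realType) (m p : nat) (v : 'rV[R]_m) (M : 'M[R]_(m, p)) j :
  (forall k, `|v 0 k| <= 1) -> `|(v *m M) 0 j| <= \sum_k \sum_l `|M k l|.
Proof.
move=> v1; rewrite mxE; apply: le_trans (ler_norm_sum _ _ _) _.
apply: ler_sum => k _; rewrite normrM; apply: le_trans (ler_piMl _ (v1 k)) _ => //.
by rewrite (bigD1 j)//= lerDl sumr_ge0.
Qed.

Lemma enorm_coord_le (R : realType) (m : nat) (v : 'rV[R]_m) k : `|v 0 k| <= enorm v.
Proof.
rewrite -(@ler_pXn2r _ 2)// ?nnegrE ?sqrtr_ge0// sqr_sqrtr.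
  rewrite real_normK ?num_real// /dotp (bigD1 k)//= -expr2 lerDl sumr_ge0// => i _.
  by rewrite -expr2 sqr_ge0.
by rewrite /dotp sumr_ge0// => i _; rewrite -expr2 sqr_ge0.
Qed.

Lemma norm_sum_le (R : realType) (d : nat) (f : 'I_d -> R) (M : R) :
  (forall i, `|f i| <= M) -> `|\sum_i f i| <= d%:R * M.
Proof.
move=> fM; apply: le_trans (ler_norm_sum _ _ _) _.
by apply: le_trans (ler_sum _ (fun i _ => fM i)) _; rewrite sumr_const card_ord mulr_natl.
Qed.

Section kernel.
Context {R : realType} {d : nat}.
Local Notation V := 'rV[R]_d.
Variables (c : V) (kappa : R).
Hypothesis kappa_gt0 : 0 < kappa.
Local Notation ker a := (riesz c a (- (kappa / 2))).

Lemma kernel_antitone (t u : R) : 0 < t -> t <= u ->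
  u `^ (- (kappa / 2)) <= t `^ (- (kappa / 2)).
Proof.
move=> t0 tu; rewrite !powRN lef_pV2 ?posrE ?powR_gt0//; last exact: lt_le_trans tu.
have u0 : 0 <= u := le_trans (ltW t0) tu.
by apply: ge0_ler_powR; rewrite ?nnegrE ?(ltW t0)// divr_ge0// ltW.
Qed.

Lemma kernel_le (a t : R) (x : V) : 0 < a -> 0 < t -> t <= a + dist2 c x ->
  ker a x <= t `^ (- (kappa / 2)).
Proof. by move=> a0 t0 ta; exact: kernel_antitone. Qed.

Lemma kernel_measurable a (D : set (borel R d)) : 0 < a -> measurable D ->
  measurable_fun D (ker a : borel R d -> R).
Proof.
move=> a0 mD; apply: borel_continuous => //.
exact: (Ck_continuous (Ck_riesz c a0 0 _)).
Qed.

Lemma dist2_out (s : R) (x : V) : 0 <= s -> ~ cube c s x -> s ^+ 2 <= dist2 c x.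
Proof.
move=> s0 /negP; rewrite -ltNge => sx.
rewrite leNgt; apply/negP => dx.
suff : cube c s x by rewrite /cube/= leNgt sx.
apply/cube_coord => // j; rewrite -(@ler_pXn2r _ 2)// ?nnegrE//.
by rewrite real_normK ?num_real//; apply: le_trans (ltW dx); exact: coord_le_dist2.
Qed.

Lemma dist2_cube (s : R) (x : V) : 0 <= s -> dist2 c x <= s ^+ 2 -> cube c s x.
Proof.
move=> s0 dx; apply/cube_coord => // j; rewrite -(@ler_pXn2r _ 2)// ?nnegrE//.
by rewrite real_normK ?num_real//; apply: le_trans dx; exact: coord_le_dist2.
Qed.

Lemma cube_dist2 (s : R) (x : V) : 0 <= s -> cube c s x -> dist2 c x <= d%:R * s ^+ 2.
Proof.
move=> s0 /cube_coord H; apply: le_trans (ler_norm _) _.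
apply: norm_sum_le => i; rewrite normrX; have := H s0 i => Hi.
by rewrite ler_pXn2r ?nnegrE.
Qed.

End kernel.

(** * The test field *)

Section test_estimates.
Context {R : realType} {d : nat}.
Local Notation V := 'rV[R]_d.
Local Notation e_ i := (delta_mx 0 i : V).
Variables (c : V) (kappa a : R) (chi : V -> R).
Hypotheses (a_gt0 : 0 < a) (kappa_gt0 : 0 < kappa).
Hypotheses (Cchi : forall k, Ck k chi) (chi01 : forall x, 0 <= chi x <= 1).

Local Notation ker := (riesz c a (- (kappa / 2))).
Local Notation ker' := (riesz c a (- (kappa / 2) - 1)).

(** The exponent [- kappa / 2] on the squared distance makes this field
    [chi (x - c) |x - c|^(- kappa)] up to the regularization [a]. *)
Definition test_field (x : V) : V :=
  \row_j (chi x * ((x 0 j - c 0 j) * riesz c a (- (kappa / 2)) x)).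

Lemma test_fieldE x j : test_field x 0 j = chi x * ((x 0 j - c 0 j) * ker x).
Proof. by rewrite mxE. Qed.

Lemma Ck_test_field k j : Ck k (fun x => test_field x 0 j).
Proof.
under eq_fun do rewrite test_fieldE.
by apply: Ck_mul => //; apply: Ck_mul; [exact: Ck_shift|exact: Ck_riesz].
Qed.

Lemma derive_test_field i j x : 'D_(e_ i) (fun y => test_field y 0 j) x =
  chi x * ((i == j)%:R * ker x - kappa * (x 0 i - c 0 i) * (x 0 j - c 0 j) * ker' x)
  + (x 0 j - c 0 j) * ker x * 'D_(e_ i) chi x.
Proof.
under eq_fun do rewrite test_fieldE.
have Dk := is_derive_riesz c a_gt0 (- (kappa / 2)) i x.
have Dx := is_derive_shift_coord c i j x.
have Dc := Ck_is_derive (Cchi 1) i x.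
have [_ +] := is_deriveM Dc (is_deriveM Dx Dk).
move=> DE; have {}DE := DE; rewrite /GRing.scale/= in DE.
apply: (etrans DE); rewrite [X in _ + X * _](_ : _ = (x 0 j - c 0 j) * ker x)//.
have -> : 2 * - (kappa / 2) = - kappa by lra.
ring.
Qed.

Lemma kernel_ge0 x : 0 <= ker x. Proof. exact: powR_ge0. Qed.
Lemma kernel'_ge0 x : 0 <= ker' x. Proof. exact: powR_ge0. Qed.

(** Turns the kernel of exponent [- kappa / 2 - 1] that appears in derivatives,
    once multiplied by the squared distance, into the original kernel. *)
Lemma riesz_rec x : ker x = (a + dist2 c x) * ker' x.
Proof.
have H := riesz_base_gt0 c a_gt0 x.
rewrite /riesz -{2}(powRr1 (ltW H)) -powRD; last by apply/implyP => _; rewrite gt_eqF.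
by congr (_ `^ _); ring.
Qed.

Lemma dist2_kernel'_le x : dist2 c x * ker' x <= ker x.
Proof. by rewrite riesz_rec ler_wpM2r ?kernel'_ge0// lerDr ltW. Qed.

Lemma prod_coord_le i j (x : V) :
  `|(x 0 i - c 0 i) * (x 0 j - c 0 j)| <= dist2 c x.
Proof.
have := coord_le_dist2 c x i; have := coord_le_dist2 c x j.
set u := x 0 i - _; set v := x 0 j - _; move=> vq uq.
have /= := sqr_ge0 (u - v); have /= := sqr_ge0 (u + v).
rewrite ler_norml => H1 H2; apply/andP; split; nra.
Qed.

(** The derivatives of the field are controlled by the kernel itself, not by a
    more singular one: the factor [x - c] compensates the loss of one power. *)
Lemma norm_derive_test_field i j (x : V) :
  `|'D_(e_ i) (fun y => test_field y 0 j) x| <=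
  ker x * (1 + kappa + `|x 0 j - c 0 j| * `|'D_(e_ i) chi x|).
Proof.
rewrite derive_test_field.
apply: le_trans (ler_normD _ _) _.
rewrite [leRHS]mulrDr lerD//; last first.
  by rewrite !normrM (ger0_norm (kernel_ge0 x)) [_ * ker x]mulrC -mulrA.
have /andP[chi0 chi1] := chi01 x.
rewrite normrM ger0_norm// -[leRHS]mul1r ler_pM//.
apply: le_trans (ler_normB _ _) _.
rewrite [leRHS]mulrDr mulr1 lerD//.
  by rewrite normrM (ger0_norm (kernel_ge0 x)) ger0_norm// ler_piMl ?kernel_ge0//; case: eqP.
rewrite -2!mulrA [_ * (_ * ker' x)]mulrA normrM gtr0_norm// [leRHS]mulrC.
rewrite ler_wpM2l ?(ltW kappa_gt0)// normrM (ger0_norm (kernel'_ge0 x)).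
apply: le_trans (dist2_kernel'_le x).
by rewrite ler_wpM2r ?kernel'_ge0 ?prod_coord_le.
Qed.

(** The divergence of [(x - c) k] is [d k - kappa |x - c|^2 k / (a + |x - c|^2)],
    and the last quotient is at most [k]. *)
Lemma div_test_field_ge (x : V) :
  ker x * ((d%:R - kappa) * chi x
    - \sum_(i < d) `|x 0 i - c 0 i| * `|'D_(e_ i) chi x|)
  <= \sum_(i < d) 'D_(e_ i) (fun y => test_field y 0 i) x.
Proof.
under [leRHS]eq_bigr do rewrite derive_test_field eqxx mul1r.
rewrite big_split/= mulrBr mulr_sumr -sumrN lerD//; last first.
  apply: ler_sum => i _; rewrite [_ * ker x]mulrC -mulrA -mulrN ler_wpM2l ?kernel_ge0//.
  by rewrite -normrM lerNl -normrN ler_norm.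
have /andP[chi0 chi1] := chi01 x.
have -> : \sum_(i < d) chi x * (ker x - kappa * (x 0 i - c 0 i) * (x 0 i - c 0 i) * ker' x)
   = chi x * (d%:R * ker x - kappa * (dist2 c x * ker' x)).
  rewrite -mulr_sumr sumrB sumr_const card_ord; congr (_ * (_ - _)); first by rewrite mulr_natl.
  by rewrite /dist2 mulr_suml mulr_sumr; apply: eq_bigr => i _; ring.
have := dist2_kernel'_le x.
move=> /(ler_wpM2l (ltW kappa_gt0)) /(ler_wpM2l chi0).
rewrite mulrBr; move: (chi x) (ker x) (dist2 c x * ker' x) => X K Q.
nra.
Qed.

(** [A] stands for [M (sigma x) *m W] and [B] for the zero order term.  Writing
    [A = 1 + (A - 1)], the identity produces the divergence and the rest is an
    error of size [alpha]. *)
Lemma integrand_ge (A : 'M[R]_d) (B : V) (s alpha Lam D : R) (x : V) :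
  0 <= s -> 0 <= alpha -> 0 <= Lam -> 0 <= D ->
  (forall i, `|x 0 i - c 0 i| <= s) -> (forall i, `|'D_(e_ i) chi x| <= D) ->
  (forall i j, `|A i j - (i == j)%:R| <= alpha) -> (forall i, `|B 0 i| <= Lam) ->
  ker x * ((d%:R - kappa) * chi x - d%:R * (s * D)
     - d%:R ^+ 2 * ((1 + kappa + s * D) * alpha) - d%:R * (s * Lam)) <=
  \sum_(i < d) \sum_(j < d) 'D_(e_ i) (fun y => test_field y 0 j) x * A i j
   - \sum_(j < d) test_field x 0 j * B 0 j.
Proof.
move=> s0 al0 L0 D0 xs HD HA HB.
have /andP[chi0 chi1] := chi01 x.
(* split A into the identity, which gives the divergence, and A - 1 *)
have E1 : \sum_(i < d) \sum_(j < d) 'D_(e_ i) (fun y => test_field y 0 j) x * A i j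
  = \sum_(i < d) 'D_(e_ i) (fun y => test_field y 0 i) x +
    \sum_(i < d) \sum_(j < d) 'D_(e_ i) (fun y => test_field y 0 j) x * (A i j - (i == j)%:R).
  rewrite -big_split; apply: eq_bigr => i _ /=.
  rewrite [X in _ = X + _](_ : _ = \sum_(j < d) 'D_(e_ i) (fun y => test_field y 0 j) x * (i == j)%:R).
    by rewrite -big_split; apply: eq_bigr => j _ /=; ring.
  rewrite (bigD1 i)//= eqxx mulr1 big1 ?addr0// => j ji.
  by rewrite eq_sym (negbTE ji) mulr0.
have K0 := kernel_ge0 x.
have E2 : `|\sum_(i < d) \sum_(j < d) 'D_(e_ i) (fun y => test_field y 0 j) x * (A i j - (i == j)%:R)|
   <= d%:R * (d%:R * (ker x * (1 + kappa + s * D) * alpha)).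
  apply: norm_sum_le => i; apply: norm_sum_le => j; rewrite normrM ler_pM//.
  apply: le_trans (norm_derive_test_field i j x) _.
  by rewrite ler_wpM2l// lerD2l ler_pM.
have E3 : `|\sum_(j < d) test_field x 0 j * B 0 j| <= d%:R * (s * ker x * Lam).
  apply: norm_sum_le => j; rewrite normrM ler_pM// test_fieldE !normrM (ger0_norm K0) ger0_norm//.
  by rewrite -[leRHS]mul1r ler_pM// ?mulr_ge0// ler_pM.
have E4 : `|\sum_(i < d) `|x 0 i - c 0 i| * `|'D_(e_ i) chi x| | <= d%:R * (s * D).
  by apply: norm_sum_le => j; rewrite normrM !normr_id ler_pM.
have := div_test_field_ge x.
rewrite E1; move: E2 E3 E4.
rewrite !ler_norml => /andP[E2 _] /andP[_ E3] /andP[_ E4] E5.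
have : ker x * ((d%:R - kappa) * chi x - d%:R * (s * D)) <=
   \sum_(i < d) 'D_(e_ i) (fun y => test_field y 0 i) x.
  by apply: le_trans E5; rewrite ler_wpM2l// lerD2l lerN2.
rewrite expr2; move=> E6.
lra.
Qed.

(** Used away from [c], where the kernel is bounded independently of [a]. *)
Lemma norm_integrand_le (A : 'M[R]_d) (B : V) (s alpha Lam D : R) (x : V) :
  0 <= s -> 0 <= alpha -> 0 <= Lam -> 0 <= D ->
  (forall i, `|x 0 i - c 0 i| <= s) -> (forall i, `|'D_(e_ i) chi x| <= D) ->
  (forall i j, `|A i j| <= alpha) -> (forall i, `|B 0 i| <= Lam) ->
  `|\sum_(i < d) \sum_(j < d) 'D_(e_ i) (fun y => test_field y 0 j) x * A i j
   - \sum_(j < d) test_field x 0 j * B 0 j|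
  <= ker x * (d%:R ^+ 2 * ((1 + kappa + s * D) * alpha) + d%:R * (s * Lam)).
Proof.
move=> s0 al0 L0 D0 xs HD HA HB.
have /andP[chi0 chi1] := chi01 x.
have K0 := kernel_ge0 x.
have E2 : `|\sum_(i < d) \sum_(j < d) 'D_(e_ i) (fun y => test_field y 0 j) x * A i j|
   <= d%:R * (d%:R * (ker x * (1 + kappa + s * D) * alpha)).
  apply: norm_sum_le => i; apply: norm_sum_le => j; rewrite normrM ler_pM//.
  apply: le_trans (norm_derive_test_field i j x) _.
  by rewrite ler_wpM2l// lerD2l ler_pM.
have E3 : `|\sum_(j < d) test_field x 0 j * B 0 j| <= d%:R * (s * ker x * Lam).
  apply: norm_sum_le => j; rewrite normrM ler_pM// test_fieldE !normrM (ger0_norm K0) ger0_norm//.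
  by rewrite -[leRHS]mul1r ler_pM// ?mulr_ge0// ler_pM.
apply: le_trans (ler_normB _ _) _; apply: le_trans (lerD E2 E3) _.
by rewrite le_eqVlt; apply/orP; left; apply/eqP; ring.
Qed.

End test_estimates.

(** * The equation tested against a vector field *)

(** The entries of [M v *m W], where [M v] has rows [v *m P i]. *)
Definition symbol_mx (R : realType) (d m n : nat) (P : 'I_d -> 'M[R]_(m, n))
    (W : 'M[R]_(n, d)) (v : 'rV[R]_m) : 'M[R]_d :=
  \matrix_(i, j) (v *m P i *m W) 0 j.

Lemma symbol_mxE (R : realType) (d m n : nat) (P : 'I_d -> 'M[R]_(m, n))
    (W : 'M[R]_(n, d)) (v : 'rV[R]_m) i j :
  symbol_mx P W v i j = (v *m (P i *m W)) 0 j.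
Proof. by rewrite mulmxA mxE. Qed.

Section weak_form.
Context {R : realType} {d m n : nat}.
Local Notation V := 'rV[R]_d.
Local Notation e_ i := (delta_mx 0 i : V).

Lemma dotpMr k l (u : 'rV[R]_k) (v : 'rV[R]_l) (M : 'M[R]_(l, k)) :
  dotp (u *m M^T) v = dotp u (v *m M).
Proof.
rewrite /dotp; under eq_bigr do rewrite mxE mulr_suml.
rewrite exchange_big/=; apply: eq_bigr => i _.
by rewrite mxE mulr_sumr; apply: eq_bigr => j _; rewrite mxE; ring.
Qed.

Lemma dotpDl k (u v w : 'rV[R]_k) : dotp (u + v) w = dotp u w + dotp v w.
Proof. by rewrite /dotp -big_split; apply: eq_bigr => i _; rewrite mxE mulrDl. Qed.

Lemma dotpNl k (u w : 'rV[R]_k) : dotp (- u) w = - dotp u w.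
Proof. by rewrite /dotp -sumrN; apply: eq_bigr => i _; rewrite mxE mulNr. Qed.

Lemma dotp_suml k (I : Type) (s : seq I) (u : I -> 'rV[R]_k) (w : 'rV[R]_k) :
  dotp (\sum_(i <- s) u i) w = \sum_(i <- s) dotp (u i) w.
Proof.
elim: s => [|i s IH]; last by rewrite !big_cons dotpDl IH.
by rewrite !big_nil /dotp big1// => i _; rewrite mxE mul0r.
Qed.

Variables (Omega : set V) (P0 : 'M[R]_(m, n)) (P : 'I_d -> 'M[R]_(m, n)).
Variables (mu : radon m Omega) (nu : {measure set (borel R d) -> \bar R}).
Variable sigma : borel R d -> borel R m.
Hypotheses (Hsol : solves P0 P mu) (Hpol : is_polar mu nu sigma).

Lemma near_zero_off_support (T : topologicalType) p (f : T -> 'rV[R]_p) x :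
  ~ closure [set y | f y != 0] x -> \near x, f x = 0.
Proof.
move=> /existsNP[B /not_implyP[nB AB]].
apply: filterS nB => y By; apply: contrapT => /eqP fy.
by apply: AB; exists y.
Qed.

(** The equation tested against [psi = u W^T]. *)
Lemma weak_form (u : V -> V) (W : 'M[R]_(n, d)) :
  (forall k j, Ck k (fun x => u x 0 j)) ->
  compact (closure [set x | u x != 0]) -> closure [set x | u x != 0] `<=` Omega ->
  (\int[nu]_(x in (Omega : set (borel R d)))
    (- (\sum_(i < d) \sum_(j < d) 'D_(e_ i) (fun y => u y 0 j) x * symbol_mx P W (sigma x) i j
        - \sum_(j < d) u x 0 j * (sigma x *m P0 *m W) 0 j))%:E = 0)%E.
Proof.
move=> Cu cu suO.
pose psi x := u x *m W^T.
have psij x j : psi x 0 j = \sum_k W j k * u x 0 k.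
  by rewrite mxE; apply: eq_bigr => k _; rewrite mxE mulrC.
have Cpsi k j : Ck k (fun x => psi x 0 j).
  under eq_fun do rewrite psij.
  by apply: Ck_sum => l; apply: Ck_mul; [exact: Ck_cst|exact: Cu].
have spsi := smooth_Ck Cpsi.
have sub1 : closure [set x | psi x != 0] `<=` closure [set x | u x != 0].
  by apply: closureS => x /=; apply: contra => /eqP; rewrite /psi => ->; rewrite mul0mx.
have cpsi : compact (closure [set x | psi x != 0]).
  by apply: subclosed_compact sub1 => //; exact: closed_closure.
have Ccpsi : Cc Omega psi.
  split => //; last exact: subset_trans suO.
  exact: (spsi [::]).1.
pose phi x := - (\sum_(i < d) partial i psi x *m (P i)^T) + psi x *m P0^T.
have phi0 : closure [set x | phi x != 0] `<=` closure [set x | psi x != 0].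
  rewrite [X in _ `<=` X]((closure_id _).1 (@closed_closure _ _)).
  apply: closureS => x /=; apply: contraPP => /near_zero_off_support psi0.
  apply/negP; rewrite negbK; apply/eqP; rewrite /phi.
  rewrite (nbhs_singleton psi0) mul0mx addr0 big1 ?oppr0// => i _.
  rewrite /partial (near_eq_derive _ (g := fun=> 0)) ?derive_cst ?mul0mx//.
have cphi : continuous phi.
  apply: continuous_row => j.
  have -> : (fun x => phi x 0 j) = (fun x =>
      - 1 * (\sum_(i < d) \sum_k partial i psi x 0 k * P i j k)
      + \sum_k psi x 0 k * P0 j k).
    apply/funext => y; rewrite /phi !mxE summxE mulN1r; congr (- _ + _).
      by apply: eq_bigr => i _; rewrite mxE; apply: eq_bigr => k _; rewrite mxE.
    by apply: eq_bigr => k _; rewrite /psi !mxE.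
  have cp i k : Ck 0 (fun x => partial i psi x 0 k).
    split => // y.
    apply: (@continuous_comp _ _ _ (partial i psi) (fun M : 'rV_n => M 0 k)).
      exact: ((spsi [:: i]).1 y).
    exact: coord_continuous.
  suff /Ck_continuous : Ck 0 (fun x =>
      - 1 * (\sum_(i < d) \sum_k partial i psi x 0 k * P i j k)
      + \sum_k psi x 0 k * P0 j k) by [].
  apply: Ck_add.
    apply: Ck_mul; first exact: Ck_cst.
    apply: Ck_sum => i; apply: Ck_sum => k.
    by apply: Ck_mul; [exact: cp|exact: Ck_cst].
  by apply: Ck_sum => k; apply: Ck_mul; [exact: Cpsi|exact: Ck_cst].
have Ccphi : Cc Omega phi.
  split => //; last by apply: subset_trans suO; exact: subset_trans sub1.
  by apply: subclosed_compact phi0 => //; exact: closed_closure.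
have [_ _ /(_ _ Ccphi)] := Hpol.
rewrite (Hsol spsi Ccpsi) => E0; rewrite [RHS]E0.
apply: eq_integral => x _; congr EFin; rewrite opprB addrC.
rewrite /phi dotpDl dotpNl dotp_suml dotpMr /psi dotpMr.
congr (- _ + _).
apply: eq_bigr => i _; rewrite dotpMr.
rewrite /dotp; under eq_bigr do rewrite mxE.
have -> : partial i psi x = (\row_j 'D_(e_ i) (fun y => u y 0 j) x) *m W^T.
  apply/rowP => j; rewrite partialE; last by move=> l; exact: ((Cpsi 1 l).2 i).1.
  under eq_fun do rewrite psij.
  rewrite mxE.
  have H k : is_derive x (e_ i) (fun y => W j k * u y 0 k) (W j k * 'D_(e_ i) (fun y => u y 0 k) x).
    have := @is_deriveZ _ _ _ (fun y => u y 0 k) (W j k) x (e_ i) _ (Ck_is_derive (Cu 1 k) i x).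
    by [].
  have -> : (fun y => \sum_k W j k * u y 0 k) = \sum_k (fun y => W j k * u y 0 k).
    by apply/funext => y; rewrite fct_sumE.
  have [_ ->] := is_derive_sum H.
  by apply: eq_bigr => k _; rewrite !mxE mulrC.
rewrite -/(dotp _ _) dotpMr; apply: eq_bigr => j _.
by rewrite !mxE.
Qed.

End weak_form.

Section equation.
Context {R : realType} {d m n : nat}.
Local Notation V := 'rV[R]_d.
Local Notation e_ i := (delta_mx 0 i : V).
Variables (Omega : set V) (P0 : 'M[R]_(m, n)) (P : 'I_d -> 'M[R]_(m, n)).
Variables (mu : radon m Omega) (nu : {measure set (borel R d) -> \bar R}).
Variable sigma : borel R d -> borel R m.
Hypotheses (oO : open Omega) (Hsol : solves P0 P mu) (Hpol : is_polar mu nu sigma).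

Let mO : measurable (Omega : set (borel R d)). Proof. exact: borel_open. Qed.

Lemma measurable_polar_mul p (M : 'M[R]_(m, p)) j :
  measurable_fun (Omega : set (borel R d)) (fun x => (sigma x *m M) 0 j).
Proof.
have [ms _ _] := Hpol.
apply: (@measurableT_comp _ _ _ _ _ _ (fun v : borel R m => (v *m M) 0 j)) => //.
apply: borel_continuous => //.
have -> : (fun v : 'rV[R]_m => (v *m M) 0 j) = (fun v => \sum_k v 0 k * M k j).
  by apply/funext => v; rewrite mxE.
apply: (@Ck_continuous _ _ 0); apply: Ck_sum => k.
by apply: Ck_mul; [exact: Ck_coord|exact: Ck_cst].
Qed.

Definition integrand (W : 'M[R]_(n, d)) (u : V -> V) (x : borel R d) : R :=
  \sum_(i < d) \sum_(j < d) 'D_(e_ i) (fun y => u y 0 j) x * symbol_mx P W (sigma x) i j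
  - \sum_(j < d) u x 0 j * (sigma x *m P0 *m W) 0 j.

Lemma measurable_integrand W (u : V -> V) : (forall k j, Ck k (fun x => u x 0 j)) ->
  measurable_fun (Omega : set (borel R d)) (integrand W u).
Proof.
move=> Cu; apply: measurable_funB.
  apply: measurable_sum => i; apply: measurable_sum => j.
  apply: measurable_funM.
    by apply: borel_continuous => //; exact: (@Ck_continuous _ _ 0 _ ((Cu 1 j).2 i).2).
  under eq_fun do rewrite symbol_mxE; exact: measurable_polar_mul.
apply: measurable_sum => j; apply: measurable_funM.
  by apply: borel_continuous => //; exact: (Ck_continuous (Cu 0 j)).
under eq_fun do rewrite -mulmxA; exact: measurable_polar_mul.
Qed.

Lemma integrand_outside W (u : V -> V) x :
  ~ closure [set x | u x != 0] x -> integrand W u x = 0.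
Proof.
move=> /near_zero_off_support u0; rewrite /integrand big1 ?big1 ?subrr//.
  by move=> j _; rewrite (nbhs_singleton u0) mxE mul0r.
move=> i _; rewrite big1// => j _.
rewrite (near_eq_derive _ (g := fun=> 0)) ?derive_cst ?mul0r//.
by apply: filterS u0 => y ->; rewrite mxE.
Qed.

(** The polar is a unit vector only almost everywhere; restricting to this set
    makes the integrands bounded at every point. *)
Definition unit_polar : set (borel R d) :=
  [set x | Omega x /\ forall k, `|sigma x 0 k| <= 1].

Lemma measurable_unit_polar : measurable unit_polar.
Proof.
have -> : unit_polar = Omega `&` \bigcap_(k in [set: 'I_m])
    (Omega `&` [set x | `|(sigma x *m 1%:M) 0 k| <= 1]).
  apply/seteqP; split => [x [Ox H]|x [Ox H]]; split => //.
    by move=> k _; split => //=; rewrite mulmx1.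
  by move=> k; have [_ /=] := H k I; rewrite mulmx1.
apply: measurableI => //; apply: fin_bigcap_measurable => // k _.
have := @measurableT_comp _ _ _ _ _ _ _ _ _ (@normr_measurable R setT) (measurable_polar_mul 1%:M k).
move=> /(_ mO `]-oo, 1]%classic (measurable_itv _)).
by rewrite (_ : _ @^-1` _ = [set x | `|(sigma x *m 1%:M) 0 k| <= 1])//;
  apply/seteqP; split => x /=; rewrite in_itv.
Qed.

Lemma ae_unit_polar : {ae nu, forall x, Omega x -> unit_polar x}.
Proof.
have [_ H _] := Hpol; apply: (@filterS _ _ (ae_filter_ringOfSetsType nu)) H => x H Ox; split => // k.
by rewrite -(H Ox) enorm_coord_le.
Qed.

(** The vanishing integral of [weak_form], cut down to a compact set where the
    integrand is bounded, so that the integral may be split. *)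
Lemma integral_integrand (W : 'M[R]_(n, d)) (u : V -> V) (B : set V) :
  (forall k j, Ck k (fun x => u x 0 j)) ->
  closure [set x | u x != 0] `<=` B -> compact B -> B `<=` Omega ->
  (\int[nu]_(x in (B : set (borel R d)) `&` unit_polar) (- integrand W u x)%:E = 0)%E.
Proof.
move=> Cu uB cB BO.
have clB := compact_closed (@norm_hausdorff _ _) cB.
have mB : measurable (B : set (borel R d)) by exact: borel_closed.
have cu : compact (closure [set x | u x != 0]).
  by apply: subclosed_compact uB => //; exact: closed_closure.
have <- := weak_form Hsol Hpol W Cu cu (subset_trans uB BO).
have -> : (B : set (borel R d)) `&` unit_polar = Omega `&` (B `&` unit_polar).
  by apply/seteqP; split => x; [move=> [Bx [Ox ?]]|move=> [_ [Bx Ux]]].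
rewrite integral_mkcondr.
have mI : measurable_fun (Omega : set (borel R d)) (fun x => (- integrand W u x)%:E).
  by apply/measurable_EFinP; apply: measurableT_comp => //; exact: measurable_integrand.
apply: ae_eq_integral => //.
  rewrite -measurable_restrict//; last by apply: measurableI => //; exact: measurable_unit_polar.
  apply: measurable_funS mI => //.
apply: (@filterS _ _ (ae_filter_ringOfSetsType nu)) ae_unit_polar => x Ux Ox.
rewrite patchE; case: ifPn => //; rewrite notin_setE => nBx.
rewrite -/(integrand W u x) integrand_outside ?oppr0// => /uB Bx; apply: nBx; split => //; exact: Ux.
Qed.

(** The points where [W] is a right inverse of [M (sigma x)] up to [eps]. *)
Definition nearly_inverted (W : 'M[R]_(n, d)) (eps : R) : set (borel R d) :=
  [set x | Omega x /\ forall i j, `|symbol_mx P W (sigma x) i j - (i == j)%:R| <= eps].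

Lemma measurable_nearly_inverted W eps : measurable (nearly_inverted W eps).
Proof.
have -> : nearly_inverted W eps = Omega `&` \bigcap_(ij in [set: 'I_d * 'I_d])
    (Omega `&` [set x | `|(sigma x *m (P ij.1 *m W)) 0 ij.2 - (ij.1 == ij.2)%:R| <= eps]).
  apply/seteqP; split => [x [Ox H]|x [Ox H]]; split => //.
    by move=> [i j] _; split => //=; have := H i j; rewrite symbol_mxE.
  by move=> i j; have [_ /=] := H (i, j) I; rewrite symbol_mxE.
apply: measurableI => //; apply: fin_bigcap_measurable => // -[i j] _ /=.
have := @measurableT_comp _ _ _ _ _ _ _ _ _ (@normr_measurable R setT)
  (measurable_funB (measurable_polar_mul (P i *m W) j) (measurable_cst ((i == j)%:R : R))).
move=> /(_ mO `]-oo, eps]%classic (measurable_itv _)).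
by rewrite (_ : _ @^-1` _ = [set x | `|(sigma x *m (P i *m W)) 0 j - (i == j)%:R| <= eps])//;
  apply/seteqP; split => x /=; rewrite in_itv.
Qed.

End equation.

(** * The energy bound *)

(** Chosen so that the error on [nearly_inverted], at most
    [d^2 (2 + kappa) inversion_tol] times the kernel, is [(d - kappa) / 8] times
    the kernel. *)
Definition inversion_tol (R : realType) (d : nat) (kappa : R) : R :=
  (d%:R - kappa) / (8 * d%:R ^+ 2 * (2 + kappa)).

Section pointwise.
Context {R : realType} {d m n : nat}.
Local Notation V := 'rV[R]_d.
Local Notation e_ i := (delta_mx 0 i : V).
Variables (Omega : set V) (P0 : 'M[R]_(m, n)) (P : 'I_d -> 'M[R]_(m, n)).
Variables (mu : radon m Omega) (nu : {measure set (borel R d) -> \bar R}).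
Variable sigma : borel R d -> borel R m.
Hypotheses (oO : open Omega) (Hsol : solves P0 P mu) (Hpol : is_polar mu nu sigma).
Variable kappa : R.
Hypotheses (kappa_gt0 : 0 < kappa) (kappa_lt : kappa < d%:R).

Local Notation ker c a := (riesz c a (- (kappa / 2))).
Local Notation good W := (nearly_inverted Omega P sigma W (inversion_tol d kappa)).

Let d0 : 0 < d%:R :> R. Proof. exact: lt_trans kappa_lt. Qed.

Lemma inversion_tol_ge0 : 0 <= inversion_tol d kappa.
Proof. by rewrite divr_ge0 ?subr_ge0 ?(ltW kappa_lt)// !mulr_ge0// ?addr_ge0// ?exprn_ge0// ltW. Qed.

Lemma inversion_tolE : d%:R ^+ 2 * (2 + kappa) * inversion_tol d kappa = (d%:R - kappa) / 8.
Proof.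
have dn : d%:R != 0 :> R by rewrite gt_eqF.
have kn : 2 + kappa != 0 by rewrite gt_eqF// addr_gt0.
by rewrite /inversion_tol; field; rewrite dn kn.
Qed.

(** Near [c] the cutoff is at least 1/2 and the terms with a derivative of the
    cutoff or with [P0] carry a factor [x - c], so on [nearly_inverted] a quarter
    of [(d - kappa) k_a] survives.  Off that set the constant [C] pays, and outside
    the cube [M] does.  The order of the quantifiers matters: [C] depends only on
    [W], and [M] does not depend on [a]. *)
Lemma integrand_lower_bound (W : 'M[R]_(n, d)) : exists2 C : R, 0 <= C &
  forall (c : V) (rho : R), 0 < rho ->
  exists (chi : V -> R), [/\ forall k, Ck k chi, forall x, 0 <= chi x <= 1,
    closure [set x | chi x != 0] `<=` cube c rho &
  exists2 s1 : R, 0 < s1 <= rho & forall s, 0 < s <= s1 ->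
  exists2 M : R, 0 <= M & forall (a : R), 0 < a ->
   (exists N : R, forall x, cube c rho x -> unit_polar Omega sigma x ->
       `|integrand P0 P sigma W (test_field c kappa a chi) x| <= N) /\
   forall x, cube c rho x -> unit_polar Omega sigma x ->
   (d%:R - kappa) / 4 * (ker c a x * \1_(cube c s) x)
    - integrand P0 P sigma W (test_field c kappa a chi) x
   <= C * (ker c a x * \1_(cube c s `\` good W) x) + M].
Proof.
(* bounds all entries of M v W and of v P0 W when the entries of v are at most 1 *)
pose Lam : R := 1 + (\sum_(i < d) \sum_k \sum_l `|(P i *m W) k l|) + \sum_k \sum_l `|(P0 *m W) k l|.
have S1 : 0 <= \sum_(i < d) \sum_k \sum_l `|(P i *m W) k l|.
  by apply: sumr_ge0 => i _; apply: sumr_ge0 => k _; apply: sumr_ge0.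
have S2 : 0 <= \sum_k \sum_l `|(P0 *m W) k l|.
  by apply: sumr_ge0 => k _; apply: sumr_ge0.
have L0 : 0 <= Lam by rewrite /Lam; lra.
have LA x i j : unit_polar Omega sigma x -> `|symbol_mx P W (sigma x) i j| <= Lam.
  move=> [_ Ux]; rewrite symbol_mxE; apply: le_trans (norm_row_mul_le _ j Ux) _.
  rewrite /Lam (bigD1 i)//=.
  have : 0 <= \sum_(i0 < d | i0 != i) \sum_k \sum_l `|(P i0 *m W) k l|.
    by apply: sumr_ge0 => i0 _; apply: sumr_ge0 => k _; apply: sumr_ge0.
  lra.
have LB x j : unit_polar Omega sigma x -> `|(sigma x *m P0 *m W) 0 j| <= Lam.
  move=> [_ Ux]; rewrite -mulmxA; apply: le_trans (norm_row_mul_le _ j Ux) _.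
  by rewrite /Lam; lra.
clearbody Lam.
exists (d%:R ^+ 2 * (2 + kappa) * (Lam + 1)).
  by rewrite !mulr_ge0 ?exprn_ge0 ?addr_ge0// ltW.
move=> c rho rho0.
have [chi [Cchi chi01 chic chis]] := smooth_cutoff c (exprn_gt0 2 rho0).
exists chi; split => //.
  have cl : closed [set x | dist2 c x <= rho ^+ 2].
    apply: (@preimage_closed _ _ (dist2 c) [set t | t <= rho ^+ 2]) => //.
      by move=> x _; exact: (Ck_continuous (Ck_dist2 c 0)).
  move=> x clx; apply: dist2_cube; first exact: ltW.
  suff : [set x | dist2 c x <= rho ^+ 2] x by [].
  rewrite [X in X x]((closure_id _).1 cl); apply: closureS clx => y /= /chis; exact: ltW.
have HD i := compact_norm_bound (@compact_cube _ _ c rho) (@Ck_continuous _ _ 0 _ ((Cchi 1%N).2 i).2).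
pose D : R := \sum_i s2val (cid2 (HD i)).
have DM i : 0 <= s2val (cid2 (HD i)) by case: cid2.
have D0 : 0 <= D by apply: sumr_ge0.
have DP x i : cube c rho x -> `|'D_(e_ i) chi x| <= D.
  move=> xc; rewrite /D (bigD1 i)//=; apply: ler_wpDr; first by apply: sumr_ge0.
  by case: cid2 => M /= M0; exact.
clearbody D; clear HD DM.
have [e0 e00 chie] : exists2 e0 : R, 0 < e0 & forall x, cube c e0 x -> 1 / 2 <= chi x.
  have cc : continuous chi := Ck_continuous (Cchi 0%N).
  have h2 : (0 : R) < 1 / 2 by lra.
  have /cvgrPdist_le /(_ _ h2) /nbhs_ballP := cc c.
  move=> [e /= e0 He]; exists (e / 2); first by rewrite divr_gt0.
  move=> x xc; have : ball c e x.
    by rewrite -ball_normE /=; apply: le_lt_trans xc _; rewrite ltr_pdivrMr//; lra.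
  by move=> /He /=; rewrite chic ler_norml; lra.
(* on cubes of this size chi >= 1/2, and the error terms without A - 1 are below (d - kappa) / 8 *)
pose s1 : R := Num.min rho (Num.min e0 (Num.min (D + 1)^-1 ((d%:R - kappa) / (8 * d%:R * (D + Lam) + 8)))).
have DL : 0 <= d%:R * (D + Lam) by rewrite mulr_ge0 ?addr_ge0// ltW.
exists s1.
  have q1 : 0 < (D + 1)^-1 by rewrite invr_gt0; lra.
  have q2 : 0 < (d%:R - kappa) / (8 * d%:R * (D + Lam) + 8).
    apply: divr_gt0; first by rewrite subr_gt0.
    by rewrite ltr_wpDl// -mulrA mulr_ge0.
  by rewrite ge_min lexx andbT !lt_min rho0 e00 q1 q2.
move=> s /andP[s0]; rewrite !le_min => /and4P[srho se0 sD sL].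
have sD1 : s * D <= 1.
  have D1 : 0 < D + 1 by lra.
  move: sD; rewrite -[_^-1]mul1r ler_pdivlMr// => sD; lra.
have sL1 : d%:R * (s * D) + d%:R * (s * Lam) <= (d%:R - kappa) / 8.
  have D1 : 0 < 8 * d%:R * (D + Lam) + 8 by rewrite ltr_wpDl// -mulrA mulr_ge0.
  move: sL; rewrite ler_pdivlMr// => sL; lra.
pose E : R := d%:R ^+ 2 * ((1 + kappa + rho * D) * Lam) + d%:R * (rho * Lam).
have E0 : 0 <= E.
  by rewrite addr_ge0// !mulr_ge0 ?exprn_ge0 ?addr_ge0 ?mulr_ge0// ltW.
exists ((s ^+ 2) `^ (- (kappa / 2)) * E); first by rewrite mulr_ge0// powR_ge0.
move=> a a0.
have Habs x : cube c rho x -> unit_polar Omega sigma x ->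
   `|integrand P0 P sigma W (test_field c kappa a chi) x| <= ker c a x * E.
  move=> xc Ux; apply: (norm_integrand_le a0 kappa_gt0 Cchi chi01) => //; try exact: ltW.
  - by move=> i; move/cube_coord : xc; apply; exact: ltW.
  - by move=> i; exact: DP.
  - by move=> i j; exact: LA.
  - by move=> i; exact: LB.
split.
  exists (a `^ (- (kappa / 2)) * E) => x xc Ux.
  apply: le_trans (Habs x xc Ux) _; rewrite ler_wpM2r//.
  by apply: kernel_le => //; rewrite lerDl dist2_ge0.
move=> x xc Ux; have K0 := kernel_ge0 c kappa a x.
(* outside the cube the kernel is at most (s^2)^(- kappa / 2), for every a *)
have [sx|sx] := pselect (cube c s x); last first.
  have xs : dist2 c x >= s ^+ 2 by apply: dist2_out => //; exact: ltW.
  rewrite !indicE !memNset//; last by move=> [].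
  rewrite !mulr0 sub0r add0r.
  apply: le_trans (le_trans (ler_norm _) _) _; last 2 first.
    by rewrite normrN; exact: Habs.
  rewrite ler_wpM2r//; apply: kernel_le => //; first by rewrite exprn_gt0.
  by apply: le_trans xs _; rewrite lerDr ltW.
rewrite indicE mem_set// mulr1.
have chi2 : 1 / 2 <= chi x by apply: chie; exact: cubeS sx.
have M0 : 0 <= (s ^+ 2) `^ (- (kappa / 2)) * E by rewrite mulr_ge0// powR_ge0.
have [Gx|Gx] := pselect (good W x).
  rewrite indicE memNset; last by move=> [].
  rewrite !mulr0 add0r; apply: le_trans M0.
  have := @integrand_ge _ _ c kappa a chi a0 kappa_gt0 Cchi chi01
    (symbol_mx P W (sigma x)) (sigma x *m P0 *m W) s (inversion_tol d kappa) Lam D x (ltW s0) inversion_tol_ge0 L0 D0.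
  move=> /(_ ((cube_coord _ _ (ltW s0)).1 sx) (fun i => DP x i xc) Gx.2 (fun i => LB x i Ux)).
  rewrite -/(integrand P0 P sigma W _ x) => H.
  rewrite subr_le0; apply: le_trans H; rewrite mulrC ler_wpM2l//.
  have T1 : d%:R ^+ 2 * ((1 + kappa + s * D) * inversion_tol d kappa) <= d%:R ^+ 2 * (2 + kappa) * inversion_tol d kappa.
    rewrite -[leRHS]mulrA; apply: ler_wpM2l; first by rewrite exprn_ge0// ltW.
    by apply: ler_wpM2r; [exact: inversion_tol_ge0|lra].
  rewrite inversion_tolE in T1.
  have : (d%:R - kappa) * (1/2) <= (d%:R - kappa) * chi x by rewrite ler_wpM2l// subr_ge0 ltW.
  lra.
rewrite indicE mem_set// mulr1.
have L1 : 0 <= Lam + 1 by rewrite addr_ge0.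
have HA i j : `|symbol_mx P W (sigma x) i j - (i == j)%:R| <= Lam + 1.
  apply: le_trans (ler_normB _ _) _; apply: lerD; first exact: LA.
  by case: eqP; rewrite ?normr1 ?normr0.
have H := @integrand_ge _ _ c kappa a chi a0 kappa_gt0 Cchi chi01
    (symbol_mx P W (sigma x)) (sigma x *m P0 *m W) s (Lam + 1) Lam D x (ltW s0) L1 L0 D0
  ((cube_coord _ _ (ltW s0)).1 sx) (fun i => DP x i xc) HA (fun i => LB x i Ux).
rewrite -/(integrand P0 P sigma W _ x) in H.
rewrite lerBlDr; apply: le_trans (lerD (lexx _) H).
rewrite addrAC; apply: ler_wpDr => //.
have T1 : d%:R ^+ 2 * ((1 + kappa + s * D) * (Lam + 1)) <= d%:R ^+ 2 * (2 + kappa) * (Lam + 1).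
  rewrite -[leRHS]mulrA; apply: ler_wpM2l; first by rewrite exprn_ge0// ltW.
  by apply: ler_wpM2r; [rewrite addr_ge0|lra].
have T2 : (d%:R - kappa) * (1/2) <= (d%:R - kappa) * chi x by rewrite ler_wpM2l// subr_ge0 ltW.
have T3 : 0 < d%:R - kappa by rewrite subr_gt0.
have K (g k p z : R) : 0 <= k -> g <= p + z -> g * k <= p * k + k * z.
  by move=> k0 h; have := ler_wpM2l k0 h; lra.
by apply: K => //; lra.
Qed.

End pointwise.

Section energy.
Context {R : realType} {d m n : nat}.
Local Notation V := 'rV[R]_d.
Local Notation e_ i := (delta_mx 0 i : V).
Variables (Omega : set V) (P0 : 'M[R]_(m, n)) (P : 'I_d -> 'M[R]_(m, n)).
Variables (mu : radon m Omega) (nu : {measure set (borel R d) -> \bar R}).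
Variable sigma : borel R d -> borel R m.
Hypotheses (oO : open Omega) (Hsol : solves P0 P mu) (Hpol : is_polar mu nu sigma).
Variable kappa : R.
Hypotheses (kappa_gt0 : 0 < kappa) (kappa_lt : kappa < d%:R).

Local Notation ker c a := (riesz c a (- (kappa / 2))).
Local Notation U := (unit_polar Omega sigma).
Local Notation good W := (nearly_inverted Omega P sigma W (inversion_tol d kappa)).

Lemma integral_indic_restrict (A B : set (borel R d)) (f : borel R d -> R) :
  (\int[nu]_(x in A) (f x * \1_B x)%:E = \int[nu]_(x in A `&` B) (f x)%:E)%E.
Proof.
rewrite integral_mkcondr; apply: eq_integral => x _.
by rewrite patchE indicE; case: ifPn => _; rewrite ?mulr1 ?mulr0.
Qed.

(** Integration of [integrand_lower_bound], the integral of the integrand being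
    zero by the equation. *)
Lemma energy_bound (W : 'M[R]_(n, d)) : exists2 C : R, 0 <= C &
  forall (c : V) (rho : R), 0 < rho -> cube c rho `<=` Omega ->
  (nu (cube c rho) < +oo)%E ->
  exists2 s1 : R, 0 < s1 <= rho & forall s, 0 < s <= s1 ->
  exists2 M : R, 0 <= M & forall (a : R), 0 < a ->
   (((d%:R - kappa) / 4)%:E * \int[nu]_(x in (cube c s : set (borel R d))) (ker c a x)%:E
   <= C%:E * \int[nu]_(x in (cube c s : set (borel R d)) `\` good W) (ker c a x)%:E
     + M%:E)%E.
Proof.
have [C C0 HC] := integrand_lower_bound Omega P0 P sigma kappa_gt0 kappa_lt W.
exists C => // c rho rho0 rhoO fin.
have [chi [Cchi chi01 chis [s1 s1rho Hs]]] := HC c rho rho0.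
exists s1 => // s s0s1; have [M M0 HM] := Hs s s0s1.
have /andP[s0 ss1] := s0s1.
have srho : s <= rho by move/andP : s1rho => [_]; exact: le_trans.
have mc r : measurable (cube c r : set (borel R d)) by exact: measurable_cube.
have mU : measurable U := measurable_unit_polar oO Hpol.
have mG : measurable (good W) := measurable_nearly_inverted P oO Hpol W _.
pose B := (cube c rho : set (borel R d)) `&` U.
have mB : measurable B by exact: measurableI.
have finB : (nu B < +oo)%E by apply: le_lt_trans fin; exact: measureIl.
have finr : nu (cube c rho) \is a fin_num by rewrite ge0_fin_numE ?measure_ge0.
exists (M * fine (nu (cube c rho))); first by rewrite mulr_ge0// fine_ge0.
move=> a a0; have [[N HN] Hpt] := HM a a0.
set k := ker c a in HN Hpt *.
set F := integrand P0 P sigma W _ in HN Hpt.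
set Q : set (borel R d) := cube c s.
set G := good W in Hpt mG *.
have k0 x : 0 <= k x := kernel_ge0 c kappa a x.
have mk D : measurable D -> measurable_fun (D : set (borel R d)) (k : borel R d -> R).
  by move=> mD; exact: kernel_measurable.
have Cu := Ck_test_field c kappa a0 Cchi.
have mF : measurable_fun B F.
  have mI := measurable_integrand P0 P oO Hpol W Cu.
  apply: measurable_funS mI; first exact: borel_open.
  by move=> x [_ []].
have intF0 : (\int[nu]_(x in B) (- F x)%:E = 0)%E.
  apply: (integral_integrand oO Hsol Hpol W Cu) => //; last exact: compact_cube.
  apply: subset_trans chis; apply: closureS => x /=; apply: contra => /eqP cx.
  by apply/eqP/rowP => j; rewrite test_fieldE cx mul0r mxE.
have integrableB (f : borel R d -> R) (L : R) : measurable_fun B f ->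
    (forall x, B x -> `|f x| <= L) -> nu.-integrable B (EFin \o f).
  move=> mf fL; apply: measurable_bounded_integrable => //.
  exists L; split; first exact: num_real.
  by move=> t Lt x Bx; apply: le_trans (fL x Bx) (ltW Lt).
have kbd x : k x <= a `^ (- (kappa / 2)).
  by apply: kernel_le => //; rewrite lerDl dist2_ge0.
have indic_bd (S : set (borel R d)) x : 0 <= k x * \1_S x <= a `^ (- (kappa / 2)).
  by rewrite indicE; case: (_ \in _); rewrite ?mulr1 ?mulr0 ?k0 ?kbd ?lexx ?powR_ge0.
have mki S : measurable S -> measurable_fun B (fun x : borel R d => k x * \1_S x).
  by move=> mS; apply: measurable_funM; [exact: mk|exact: measurable_indic].
pose g : R := (d%:R - kappa) / 4.
have g0 : 0 <= g by rewrite divr_ge0// subr_ge0 ltW.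
have mQ : measurable Q by exact: mc.
have mQG : measurable (Q `\` G) by exact: measurableD.
have i1 : nu.-integrable B (EFin \o (fun x => g * (k x * \1_Q x))).
  apply: (integrableB _ (g * a `^ (- (kappa / 2)))).
    by apply: measurable_funM => //; exact: mki.
  move=> x _; have /andP[h1 h2] := indic_bd Q x.
  by rewrite /= ger0_norm ?(mulr_ge0 g0 h1)// ler_wpM2l.
have i2 : nu.-integrable B (EFin \o (fun x => - F x)).
  apply: (integrableB _ N); first exact: measurableT_comp.
  by move=> x [cx Ux]; rewrite normrN; exact: HN.
have i3 : nu.-integrable B (EFin \o (fun x => C * (k x * \1_(Q `\` G) x) + M)).
  apply: (integrableB _ (C * a `^ (- (kappa / 2)) + M)).
    by apply: measurable_funD => //; apply: measurable_funM => //; exact: mki.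
  move=> x _; have /andP[h1 h2] := indic_bd (Q `\` G) x.
  rewrite /= ger0_norm; first by rewrite lerD2r ler_wpM2l.
  by rewrite addr_ge0// mulr_ge0.
have H1 : (\int[nu]_(x in B) ((EFin \o (fun x => g * (k x * \1_Q x))%R) \+ (EFin \o (fun x => - F x)%R)) x
   <= \int[nu]_(x in B) (EFin \o (fun x => C * (k x * \1_(Q `\` G) x) + M)%R) x)%E.
  apply: le_integral => //; first exact: integrableD.
  by move=> x /set_mem [cx Ux]; rewrite /= -EFinD lee_fin; exact: Hpt.
rewrite integralD_EFin// intF0 adde0 in H1.
(* restricting to unit_polar changes the cube by a null set *)
have EL : (\int[nu]_(x in B) (EFin \o (fun x => g * (k x * \1_Q x))%R) x =
    g%:E * \int[nu]_(x in Q) (k x)%:E)%E.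
  transitivity (\int[nu]_(x in B) (g%:E * (k x * \1_Q x)%:E))%E.
    by apply: eq_integral => x _; rewrite -EFinM.
  rewrite ge0_integralZl//; last 2 first.
  - by apply/measurable_EFinP; exact: mki.
  - by move=> x _; rewrite lee_fin; have /andP[] := indic_bd Q x.
  congr (_ * _)%E; rewrite integral_indic_restrict.
  have -> : B `&` Q = Q `&` U.
    apply/seteqP; split => x; first by move=> [[_ Ux] Qx].
    by move=> [Qx Ux]; split => //; split => //; exact: cubeS Qx.
  rewrite integral_mkcondr; apply: ae_eq_integral => //.
  - rewrite -measurable_restrict//; apply/measurable_EFinP; apply: mk; exact: measurableI.
  - by apply/measurable_EFinP; exact: mk.
  apply: (@filterS _ _ (ae_filter_ringOfSetsType nu)) (ae_unit_polar Hpol) => x Ux Qx.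
  rewrite patchE mem_set//; apply: Ux; apply: rhoO; exact: cubeS Qx.
rewrite EL in H1; apply: le_trans H1 _.
rewrite (_ : (fun x => _) = (fun x => (C%:E * (k x * \1_(Q `\` G) x)%:E + M%:E)%E)); last first.
  by apply/funext => x /=; rewrite EFinD EFinM.
rewrite ge0_integralD//; last 2 first.
- by move=> x _; rewrite mule_ge0// lee_fin//; have /andP[] := indic_bd (Q `\` G) x.
- by apply: measurable_funeM; apply/measurable_EFinP; exact: mki.
rewrite integral_cst//; apply: leeD; last first.
  rewrite EFinM fineK// lee_wpmul2l ?lee_fin//; exact: measureIl.
rewrite ge0_integralZl//; last 2 first.
- by apply/measurable_EFinP; exact: mki.
- by move=> x _; rewrite lee_fin; have /andP[] := indic_bd (Q `\` G) x.
rewrite lee_wpmul2l ?lee_fin// integral_indic_restrict.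
apply: ge0_subset_integral => //; first exact: measurableI.
- by apply/measurable_EFinP; exact: mk.
- by move=> x _; rewrite lee_fin.
Qed.

End energy.

(** * Covering by disjoint cubes *)

Section covering.
Context {R : realType} {d : nat}.
Local Notation V := 'rV[R]_d.
Variable nu : {measure set (borel R d) -> \bar R}.

(** The centres are taken in [S] itself, not merely in [K]: in the covering
    argument they must inherit a property of the points of [S]. *)
Lemma finite_net (K S : set V) (r : R) : compact K -> S `<=` K -> 0 < r ->
  exists s : seq V, (forall x, x \in s -> S x) /\
    (forall y, S y -> exists2 x, x \in s & cube x r y).
Proof.
move=> cK SK r0.
have cS : compact (closure S).
  have := compact_closed (@norm_hausdorff _ _) cK => clK.
  apply: subclosed_compact cK _; first exact: closed_closure.
  by rewrite [X in _ `<=` X]((closure_id _).1 clK); exact: closureS.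
move: cS; rewrite compact_cover => /(_ V S (fun x => ball x r)) [].
- by move=> x _; exact: ball_open.
- move=> y /(_ _ (nbhsx_ballx y r r0)) [x [Sx yx]].
  by exists x => //; exact: ball_sym.
move=> D DS SD; exists (finmap.enum_fset D); split.
  by move=> x xD; apply: set_mem; exact: DS.
move=> y Sy; have [x /= xD xy] := SD y (@subset_closure _ _ _ Sy).
by exists x => //; move: xy; rewrite -ball_normE => /ltW.
Qed.

Lemma seq_max (s : seq (V * R)) : s != [::] ->
  exists2 i, i \in s & forall j, j \in s -> j.2 <= i.2.
Proof.
elim: s => // i s IH _; have [->|/IH[j js jm]] := eqVneq s [::].
  by exists i; rewrite ?mem_head// => j /[!inE] /eqP ->.
have [ij|ji] := leP i.2 j.2.
  exists j; first by rewrite inE js orbT.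
  by move=> k /[!inE] /orP[/eqP -> //|/jm].
exists i; rewrite ?mem_head// => k /[!inE] /orP[/eqP -> //|/jm kj].
exact: le_trans kj (ltW ji).
Qed.

(** Vitali's selection, carried out directly on measures.  Take a largest cube,
    discard those that meet it, which its enlargement by the factor 3 covers, and
    continue with the others, which are disjoint from it; so the measures of the
    selected cubes add up. *)
Lemma vitali_measure (D : set (borel R d)) (T : R) (s : seq (V * R)) :
  measurable D -> 0 <= T ->
  (forall i, i \in s -> 0 <= i.2 /\
    (nu (cube i.1 (3 * i.2)) <= T%:E * nu (cube i.1 i.2 `&` D))%E) ->
  exists Z : set (borel R d), [/\ measurable Z,
    \bigcup_(i in [set` s]) cube i.1 i.2 `<=` Z &
    (nu Z <= T%:E * nu (\bigcup_(i in [set` s]) cube i.1 i.2 `&` D))%E].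
Proof.
move=> mD T0; have [N] := ubnP (size s); elim: N s => // N IH s sN Hs.
have mS (q : seq (V * R)) :
    measurable ((\bigcup_(i in [set` q]) cube i.1 i.2) : set (borel R d)).
  by apply: fin_bigcup_measurable => // i _; exact: measurable_cube.
have [->|sn0] := eqVneq s [::].
  exists set0; split => //; first by move=> x [].
  by rewrite measure0 mule_ge0 ?measure_ge0.
have [i is_ imax] := seq_max sn0.
pose C (j : V * R) := cube j.1 j.2.
pose s' := [seq j <- s | `[< C j `&` C i = set0 >]].
have [i0 iT] := Hs i is_.
have s'N : (size s' < N)%N.
  rewrite -ltnS; apply: leq_ltn_trans sN.
  rewrite size_filter -(count_predC (fun j => `[< C j `&` C i = set0 >]) s).
  rewrite -addn1 leq_add2l -has_count; apply/hasP; exists i => //=.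
  apply/asboolPn => Ci0; have : (C i `&` C i) i.1 by rewrite /C/cube/= subrr normr0.
  by rewrite Ci0.
have [j js'|Z' [mZ' cZ' nZ']] := IH _ s'N.
  by apply: Hs; move: js'; rewrite mem_filter => /andP[].
exists (Z' `|` cube i.1 (3 * i.2)); split.
- by apply: measurableU => //; exact: measurable_cube.
- move=> x [j js jx].
  have [ji|ji] := pselect (C j `&` C i = set0).
    left; apply: cZ'; exists j => //.
    by rewrite /= mem_filter js andbT; exact/asboolP.
  right; move/eqP/set0P : ji => [y [jy iy]].
  have ij := imax j js; rewrite /C /cube/= in jx jy iy *.
  have -> : i.1 - x = (i.1 - y) + ((y - j.1) + (j.1 - x)) by rewrite addrA !subrKA.
  apply: le_trans (ler_normD _ _) _; have := ler_normD (y - j.1) (j.1 - x).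
  rewrite (distrC y j.1); lra.
- apply: le_trans (measureU2 _ _ _) _ => //; first exact: measurable_cube.
  apply: le_trans (leeD nZ' iT) _.
  rewrite -ge0_muleDr ?measure_ge0// lee_wpmul2l ?lee_fin//.
  rewrite -measureU; last first.
  + apply/seteqP; split => // x [[[j js' jx] _] [ix _]].
    move: js'; rewrite /= mem_filter => /andP[/asboolP ji _].
    by suff : (C j `&` C i) x by rewrite ji.
  + by apply: measurableI => //; exact: measurable_cube.
  + exact: measurableI.
  have mi : measurable (cube i.1 i.2 `&` D : set (borel R d)).
    by apply: measurableI => //; exact: measurable_cube.
  apply: le_measure; [apply/mem_set/measurableU => //; exact: measurableI|
    by apply/mem_set; exact: measurableI|].
  rewrite -setIUl; apply: setSI => x [[j js' jx]|ix]; last by exists i.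
  by exists j => //; move: js'; rewrite /= mem_filter => /andP[].
Qed.

(** If [D] has small measure, then outside a set of small measure [D] is sparse in
    all cubes of the sequence, in comparison with the enlarged cubes.  The points
    violating this at the first [N] scales are covered by finitely many bad cubes,
    to which [vitali_measure] applies; the lower limit of the resulting sets
    covers all bad points. *)
Lemma weak_density (K : set V) (D : set (borel R d)) (T : R) (s : nat -> R) (j0 : nat) :
  compact K -> measurable D -> 0 <= T -> (forall j, 0 < s j) ->
  exists Z : set (borel R d), [/\ measurable Z, (nu Z <= T%:E * nu D)%E &
   forall x, K x -> ~ Z x -> forall j, (j0 <= j)%N ->
     (T%:E * nu (cube x (s j) `&` D) < nu (cube x (3 * s j)))%E].
Proof.
move=> cK mD T0 s0.
pose bad x j := [/\ K x, (j0 <= j)%N &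
  (nu (cube x (3 * s j)) <= T%:E * nu (cube x (s j) `&` D))%E].
have net N : exists q : seq (V * R),
    (forall i, i \in q -> 0 <= i.2 /\
    (nu (cube i.1 (3 * i.2)) <= T%:E * nu (cube i.1 i.2 `&` D))%E) /\
    forall x j, (j < N)%N -> bad x j -> (\bigcup_(i in [set` q]) cube i.1 i.2) x.
  elim: N => [|N [q [qb qc]]]; first by exists [::].
  have [|r [rb rc]] := @finite_net K [set x | bad x N] (s N) cK _ (s0 N).
    by move=> x [].
  exists (q ++ [seq (x, s N) | x <- r]); split.
    move=> i; rewrite mem_cat => /orP[/qb //|/mapP[x xr ->]] /=.
    by have [_ _ ?] := rb x xr; split => //; exact: ltW.
  move=> x j; rewrite ltnS leq_eqVlt => /orP[/eqP ->|jN] bx.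
    have [y yr yx] := rc x bx; exists (y, s N) => //=.
    by rewrite mem_cat map_f ?orbT.
  by have [i iq ix] := qc x j jN bx; exists i => //=; rewrite mem_cat (_ : i \in q).
have Zex N : exists Z : set (borel R d), [/\ measurable Z,
    forall x j, (j < N)%N -> bad x j -> Z x & (nu Z <= T%:E * nu D)%E].
  have [q [qb qc]] := net N; have [Z [mZ cZ nZ]] := vitali_measure mD T0 qb.
  exists Z; split => //; first by move=> x j jN bx; exact/cZ/(qc _ _ jN bx).
  apply: le_trans nZ _; rewrite lee_wpmul2l ?lee_fin// measureIr//.
  by apply: fin_bigcup_measurable => // i _; exact: measurable_cube.
pose Z N := sval (cid (Zex N)).
have HZ N := svalP (cid (Zex N)).
(* Z M catches the points that are bad at a scale below M, so Y N catches those bad at a scale below N *)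
pose Y N := \bigcap_(M in [set M | (N <= M)%N]) Z M.
have mY N : measurable (Y N).
  by apply: bigcap_measurable => [|M _]; [exists N => /=|have [] := HZ M].
exists (\bigcup_N Y N); split.
- exact: bigcupT_measurable.
- have ndY : {homo Y : a b / (a <= b)%N >-> (a <= b)%O}.
    move=> a b ab; rewrite subsetEset => x Yx M /= bM; apply: Yx => /=.
    exact: leq_trans bM.
  have cY := @nondecreasing_cvg_mu _ _ _ nu Y mY (bigcupT_measurable _ mY) ndY.
  rewrite -(cvg_lim _ cY)//; apply: lime_le; first by apply/cvg_ex; eexists; exact: cY.
  apply: nearW => N /=; have [mZ _ nZ] := HZ N; apply: le_trans nZ.
  by apply: le_measure; [by apply/mem_set; exact: mY|exact: mem_set|move=> x; apply => /=].
- move=> x Kx nZx j jj0; rewrite ltNge; apply/negP => bj; apply: nZx.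
  exists j.+1 => // M /= jM; have [_ HZM _] := HZ M.
  exact: HZM jM _.
Qed.

End covering.

(** * Density bounds *)

(** The ratio 3 is that of the enlargement in [weak_density], so that the enlarged
    cube is the next one of the sequence. *)
Definition scale (R : realType) (j : nat) : R := 3^-1 ^+ j.

(** [growth kappa ^+ j] is [scale j] to the power [- kappa]. *)
Definition growth (R : realType) (kappa : R) : R := 3 `^ kappa.

(** The sum of a geometric series of ratio [growth kappa], times the loss from
    comparing the cube with the Euclidean ball. *)
Definition stair_cst (R : realType) (d : nat) (kappa : R) : R :=
  growth kappa / (growth kappa - 1) * (1 + d%:R) `^ (kappa / 2).

Section triadic.
Context {R : realType} {d : nat}.
Local Notation V := 'rV[R]_d.
Variables (kappa : R).
Hypothesis kappa_gt0 : 0 < kappa.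
Local Notation q := (growth kappa).

Lemma scale_gt0 j : 0 < scale R j. Proof. by rewrite exprn_gt0. Qed.

Lemma scaleS j : 3 * scale R j.+1 = scale R j.
Proof. by rewrite /scale exprS mulrA mulfV ?mul1r. Qed.

Lemma growth_gt1 : 1 < q.
Proof.
have <- : 1 `^ kappa = 1 :> R by rewrite powR1.
apply: gt0_ltr_powR; rewrite ?nnegrE//; lra.
Qed.

Lemma scale_powR j : (scale R j ^+ 2) `^ (- (kappa / 2)) = q ^+ j.
Proof.
have s3 : scale R j ^+ 2 = 3 `^ (- (j%:R * 2)).
  by rewrite powRN -natrM powR_mulrn// /scale -exprM exprVn.
rewrite s3 -powRrM /growth -powR_mulrn ?powR_ge0// -powRrM.
by congr (_ `^ _); field.
Qed.

Lemma scale_powR1 j : scale R j `^ kappa = (q ^+ j)^-1.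
Proof.
rewrite -scale_powR powRN invrK -powR_mulrn ?ltW ?scale_gt0// -powRrM.
by congr (_ `^ _); field.
Qed.

Lemma geometric_le N : \sum_(i < N.+1) q ^+ i <= q / (q - 1) * q ^+ N.
Proof.
have q1 := growth_gt1; have q0 : 0 < q by lra.
have q2 : 0 < q - 1 by lra.
rewrite -(ler_pM2l q2) -subrX1.
have -> : (q - 1) * (q / (q - 1) * q ^+ N) = q ^+ N.+1.
  by rewrite exprS; field; rewrite gt_eqF.
by rewrite lerBlDr lerDl.
Qed.

Variables (c : V) (j1 : nat).
Local Notation Q j := (cube c (scale R j)).
Local Notation ker N := (riesz c (scale R (j1 + N) ^+ 2) (- (kappa / 2))).

(** A discrete version of the kernel, whose integral only involves measures of
    cubes. *)
Definition staircase (N : nat) (x : V) : R :=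
  \sum_(i < N.+1) q ^+ (j1 + i) * \1_(Q (j1 + i)) x.

Lemma staircaseS N x : staircase N.+1 x =
  staircase N x + q ^+ (j1 + N.+1) * \1_(Q (j1 + N.+1)) x.
Proof. by rewrite /staircase big_ord_recr. Qed.

Lemma growth_ge0 j : 0 <= q ^+ j.
Proof. by rewrite exprn_ge0// powR_ge0. Qed.

Lemma staircase_ge0 N x : 0 <= staircase N x.
Proof. by apply: sumr_ge0 => i _; rewrite mulr_ge0 ?growth_ge0. Qed.

Lemma staircase_top N x : Q (j1 + N) x -> q ^+ (j1 + N) <= staircase N x.
Proof.
move=> Qx; case: N Qx => [|N] Qx.
  by rewrite /staircase big_ord1 indicE mem_set// mulr1.
by rewrite staircaseS indicE mem_set// mulr1 lerDr staircase_ge0.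
Qed.

Lemma cube_scaleS j : Q j.+1 `<=` Q j.
Proof. by apply: cubeS; rewrite -[leRHS]scaleS ler_peMl// ?ltW ?scale_gt0//; lra. Qed.

(** Between two consecutive cubes the kernel is at most its value at the smaller
    scale, which is [growth kappa] times the top step there. *)
Lemma riesz_le_staircase N x : Q j1 x -> ker N x <= q * staircase N x.
Proof.
move=> Qx; have q1 := growth_gt1.
have s2 j : 0 < scale R j ^+ 2 by rewrite exprn_gt0 ?scale_gt0.
have [QNx|QNx] := pselect (Q (j1 + N) x).
  apply: (@le_trans _ _ (q ^+ (j1 + N))).
    rewrite -scale_powR; apply: kernel_le => //; first by rewrite lerDl dist2_ge0.
  apply: le_trans (staircase_top QNx) _.
  by rewrite ler_peMl ?staircase_ge0// ltW.
have dN : scale R (j1 + N) ^+ 2 <= dist2 c x by apply: dist2_out => //; rewrite ltW ?scale_gt0.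
have d0 : 0 < dist2 c x := lt_le_trans (s2 _) dN.
apply: (@le_trans _ _ (dist2 c x `^ (- (kappa / 2)))).
  by apply: kernel_le => //; rewrite lerDr ltW.
elim: N QNx {dN} => [|N IH] QNx; first by rewrite addn0 in QNx.
have mono : q * staircase N x <= q * staircase N.+1 x.
  rewrite ler_wpM2l ?powR_ge0// staircaseS lerDl mulr_ge0 ?growth_ge0//.
apply: le_trans mono.
have [QN|/IH //] := pselect (Q (j1 + N) x).
have := staircase_top QN => top.
apply: (@le_trans _ _ (q ^+ (j1 + N.+1))).
  rewrite -scale_powR; apply: kernel_antitone => //.
  by apply: dist2_out => //; rewrite ltW ?scale_gt0.
by rewrite addnS exprS ler_wpM2l ?powR_ge0.
Qed.

Lemma stair_cst_ge0 : 0 <= stair_cst d kappa.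
Proof.
have q1 := growth_gt1.
by rewrite mulr_ge0 ?powR_ge0// divr_ge0; lra.
Qed.

(** On the smallest cube containing [x] the steps sum up to a multiple of the
    largest one, which is comparable to the kernel. *)
Lemma staircase_le_riesz N x : staircase N x <= stair_cst d kappa * ker N x.
Proof.
have q1 := growth_gt1.
have s2 j : 0 < scale R j ^+ 2 by rewrite exprn_gt0 ?scale_gt0.
have top M : Q (j1 + M) x -> staircase M x <= stair_cst d kappa * ker M x.
  move=> Qx.
  have h1 : staircase M x <= q / (q - 1) * q ^+ (j1 + M).
    apply: (@le_trans _ _ (q ^+ j1 * \sum_(i < M.+1) q ^+ i)).
      rewrite mulr_sumr; apply: ler_sum => i _; rewrite exprD.
      by rewrite ler_piMr// ?mulr_ge0 ?growth_ge0// indicE; case: (_ \in _).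
    by rewrite exprD mulrCA ler_wpM2l ?growth_ge0 ?geometric_le.
  apply: le_trans h1 _.
  rewrite /stair_cst -(mulrA (q / (q - 1))) ler_wpM2l//; first by rewrite divr_ge0; lra.
  have h2 : ((1 + d%:R) * scale R (j1 + M) ^+ 2) `^ (- (kappa / 2)) <= ker M x.
    apply: kernel_antitone => //; first by rewrite ltr_wpDr ?dist2_ge0.
    rewrite mulrDl mul1r lerD2l; apply: cube_dist2 => //.
    by rewrite ltW ?scale_gt0.
  apply: le_trans (ler_wpM2l (powR_ge0 _ _) h2).
  have d1 : 0 < 1 + d%:R :> R by rewrite ltr_wpDr.
  rewrite powRM ?(ltW d1) ?(ltW (s2 _))// scale_powR mulrA powRN mulfV ?mul1r//.
elim: N => [|N IH].
  have [Qx|Qx] := pselect (Q (j1 + 0) x); first exact: top.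
  rewrite /staircase big_ord1 indicE memNset// mulr0 mulr_ge0 ?stair_cst_ge0//.
  exact: powR_ge0.
have [Qx|Qx] := pselect (Q (j1 + N.+1) x); first exact: top.
rewrite staircaseS indicE memNset// mulr0 addr0; apply: le_trans IH _.
rewrite ler_wpM2l ?stair_cst_ge0//; apply: kernel_antitone => //.
  by rewrite ltr_wpDr ?dist2_ge0.
rewrite lerD2r ler_pXn2r ?nnegrE ?(ltW (scale_gt0 _))//.
by rewrite addnS -[leRHS]scaleS ler_peMl ?(ltW (scale_gt0 _))//; lra.
Qed.

Variable nu : {measure set (borel R d) -> \bar R}.

Lemma integral_staircase N (A : set (borel R d)) : measurable A ->
  (\int[nu]_(x in A) (staircase N x)%:E =
   \sum_(i < N.+1) (q ^+ (j1 + i))%:E * nu (Q (j1 + i) `&` A))%E.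
Proof.
move=> mA; under eq_integral do rewrite /staircase -sumEFin.
rewrite ge0_integral_sum//.
- apply: eq_bigr => i _; under eq_integral do rewrite EFinM.
  rewrite ge0_integralZl//.
  + by rewrite integral_indic//; exact: measurable_cube.
  + by apply/measurable_EFinP; apply: measurable_indic; exact: measurable_cube.
  + by rewrite lee_fin growth_ge0.
- move=> i; apply/measurable_EFinP; apply: measurable_funM => //.
  by apply: measurable_indic; exact: measurable_cube.
- by move=> i x _; rewrite lee_fin mulr_ge0 ?growth_ge0.
Qed.

End triadic.

Section density.
Context {R : realType} {d : nat}.
Local Notation V := 'rV[R]_d.
Variables (kappa : R).
Hypothesis kappa_gt0 : 0 < kappa.
Variable nu : {measure set (borel R d) -> \bar R}.
Variables (c : V) (j1 : nat) (G : set (borel R d)) (gam C T M : R).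
Local Notation q := (growth kappa).
Local Notation C2 := (stair_cst d kappa).
Local Notation Q j := (cube c (scale R j) : set (borel R d)).
Local Notation ker a := (riesz c a (- (kappa / 2))).

(** With [a = s^2] at the smallest scale, the energy bound and the sparsity of the
    complement of [G] give [gam I <= C q^2 C2 I / T + constant] for the energy [I].
    For large [T] the term on the right is absorbed, so [I] is bounded
    independently of the scale, and the last step of the staircase bounds the
    measure of the smallest cube. *)
Lemma density_bound :
  measurable G -> 0 < gam -> 0 <= C -> 0 < T -> 0 <= M ->
  2 * (C * q * (q * C2)) <= gam * T ->
  (forall a, 0 < a -> (gam%:E * \int[nu]_(x in Q j1) (ker a x)%:E
     <= C%:E * \int[nu]_(x in Q j1 `\` G) (ker a x)%:E + M%:E)%E) ->
  (forall j, (j1 <= j)%N ->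
     (T%:E * nu (Q j `\` G) <= nu (cube c (3 * scale R j)))%E) ->
  (nu (cube c (3 * scale R j1)) < +oo)%E ->
  exists2 L : R, 0 <= L & forall N,
    (nu (Q (j1 + N)) <= (L * scale R (j1 + N) `^ kappa)%:E)%E.
Proof.
move=> mG gam0 C0 T0 M0 HT H1 H2 H3.
have q1 : 1 < q := growth_gt1 kappa_gt0.
have q0 : 0 < q by lra.
have qn j : 0 < q ^+ j by rewrite exprn_gt0.
have mQ j : measurable (Q j) by exact: measurable_cube.
have s0 j : 0 < scale R j := scale_gt0 j.
have QS a b : Q (a + b) `<=` Q a.
  elim: b => [|b IH]; first by rewrite addn0.
  by apply: subset_trans IH; rewrite addnS; exact: cube_scaleS.
have Qj1fin : (nu (Q j1) < +oo)%E.
  apply: le_lt_trans H3; apply: le_measure; [exact: mem_set|by apply: mem_set; exact: measurable_cube|].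
  by apply: cubeS; rewrite ler_peMl ?(ltW (s0 _))//; lra.
have fin (A : set (borel R d)) : measurable A -> A `<=` Q j1 -> nu A \is a fin_num.
  move=> mA AQ; rewrite ge0_fin_numE ?measure_ge0//.
  by apply: le_lt_trans Qj1fin; apply: le_measure; rewrite ?inE.
pose v i := fine (nu (Q (j1 + i))).
pose w i := fine (nu (Q (j1 + i) `\` G)).
pose m := fine (nu (cube c (3 * scale R j1))).
have vE i : nu (Q (j1 + i)) = (v i)%:E.
  by rewrite /v fineK//; apply: fin => //; exact: QS.
have mQG i : measurable (Q (j1 + i) `\` G) by exact: measurableD.
have wE i : nu (Q (j1 + i) `\` G) = (w i)%:E.
  by rewrite /w fineK//; apply: fin => // x [/QS].
have mE : nu (cube c (3 * scale R j1)) = m%:E.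
  by rewrite /m fineK// ge0_fin_numE ?measure_ge0.
have v0 i : 0 <= v i by rewrite fine_ge0.
have w0 i : 0 <= w i by rewrite fine_ge0.
have m0 : 0 <= m by rewrite fine_ge0.
have Tw0 : T * w 0%N <= m.
  by rewrite -lee_fin EFinM -mE -wE addn0; exact: H2.
have TwS i : T * w i.+1 <= v i.
  rewrite -lee_fin EFinM -vE -wE -(@scaleS R (j1 + i)) addnS; apply: H2.
  by rewrite -addnS leq_addr.
pose Z : R := C * q * (q ^+ j1 * m) + T * M.
have Z0 : 0 <= Z by rewrite addr_ge0// !mulr_ge0// ltW.
exists (C2 * (2 * Z / (gam * T))).
  by rewrite mulr_ge0 ?stair_cst_ge0// divr_ge0 ?mulr_ge0// ltW.
move=> N.
have a0 : 0 < scale R (j1 + N) ^+ 2 by rewrite exprn_gt0.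
have {H1} := H1 _ a0.
set k := ker _; move=> H1.
have mk (D : set (borel R d)) : measurable D -> measurable_fun D (EFin \o (k : borel R d -> R)).
  by move=> mD; apply/measurable_EFinP; exact: kernel_measurable.
have ms (D : set (borel R d)) : measurable D ->
    measurable_fun D (EFin \o (staircase kappa c j1 N : borel R d -> R)).
  move=> mD; apply/measurable_EFinP; apply: measurable_sum => i.
  by apply: measurable_funM => //; apply: measurable_indic; exact: mQ.
have k0 x : 0 <= k x := kernel_ge0 c kappa _ x.
have st0 x : 0 <= staircase kappa c j1 N x := staircase_ge0 _ _ _ _ x.
pose S := \sum_(i < N.+1) q ^+ (j1 + i) * v i.
pose SG := \sum_(i < N.+1) q ^+ (j1 + i) * w i.
have ES : (\int[nu]_(x in Q j1) (staircase kappa c j1 N x)%:E = S%:E)%E.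
  rewrite integral_staircase// /S -sumEFin; apply: eq_bigr => i _.
  by rewrite EFinM -vE; congr (_ * nu _)%E; apply: setIidl; exact: QS.
have ESG : (\int[nu]_(x in Q j1 `\` G) (staircase kappa c j1 N x)%:E = SG%:E)%E.
  rewrite integral_staircase//; last by have := mQG 0%N; rewrite addn0.
  rewrite /SG -sumEFin; apply: eq_bigr => i _.
  rewrite EFinM -wE; congr (_ * nu _)%E; rewrite setIDA; congr (_ `\` _).
  by apply: setIidl; exact: QS.
have mQG1 : measurable (Q j1 `\` G) by exact: measurableD.
have kle (D : set (borel R d)) : measurable D -> D `<=` Q j1 ->
    (\int[nu]_(x in D) (k x)%:E <= q%:E * \int[nu]_(x in D) (staircase kappa c j1 N x)%:E)%E.
  move=> mD DQ; rewrite -ge0_integralZl//; last 3 first.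
  - exact: ms.
  - by move=> x _; rewrite lee_fin.
  - by rewrite lee_fin ltW.
  apply: ge0_le_integral => //.
  - by move=> x _; rewrite lee_fin.
  - exact: mk.
  - by apply: measurable_funeM; exact: ms.
  - by move=> x Dx; rewrite -EFinM lee_fin; apply: riesz_le_staircase => //; exact: DQ.
pose I := fine (\int[nu]_(x in Q j1) (k x)%:E).
pose IG := fine (\int[nu]_(x in Q j1 `\` G) (k x)%:E).
have IE : (\int[nu]_(x in Q j1) (k x)%:E = I%:E)%E.
  rewrite /I fineK// ge0_fin_numE; last by apply: integral_ge0 => x _; rewrite lee_fin.
  by apply: le_lt_trans (kle _ (mQ _) _) _ => //; rewrite ES -EFinM ltry.
have IGE : (\int[nu]_(x in Q j1 `\` G) (k x)%:E = IG%:E)%E.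
  rewrite /IG fineK// ge0_fin_numE; last by apply: integral_ge0 => x _; rewrite lee_fin.
  by apply: le_lt_trans (kle _ mQG1 _) _ => [x []//|]; rewrite ESG -EFinM ltry.
have I1 : IG <= q * SG.
  by rewrite -lee_fin EFinM -IGE -ESG; apply: kle => // x [].
have I2 : S <= C2 * I.
  rewrite -lee_fin EFinM -IE -ES -ge0_integralZl//; last 3 first.
  - exact: mk.
  - by move=> x _; rewrite lee_fin.
  - by rewrite lee_fin stair_cst_ge0.
  apply: ge0_le_integral => //.
  - by move=> x _; rewrite lee_fin.
  - exact: ms.
  - by apply: measurable_funeM; exact: mk.
  - by move=> x Dx; rewrite -EFinM lee_fin; exact: staircase_le_riesz.
have I3 : gam * I <= C * IG + M.
  by rewrite -lee_fin EFinD !EFinM -IGE -IE.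
(* the enlargement shifts the index by one; m accounts for the cube above the first *)
have I4 : T * SG <= q ^+ j1 * m + q * S.
  rewrite /SG big_ord_recl mulrDr addn0 lerD//.
    by rewrite mulrCA ler_wpM2l// ltW.
  apply: (@le_trans _ _ (q * \sum_(i < N) q ^+ (j1 + i) * v i)).
    rewrite !mulr_sumr; apply: ler_sum => i _; rewrite lift0 addnS exprS.
    by rewrite mulrCA -!mulrA ler_wpM2l ?(ltW q0)// ler_wpM2l// ltW.
  rewrite ler_wpM2l ?(ltW q0)// /S big_ord_recr/= lerDl.
  by apply: mulr_ge0 => //; exact: ltW.
have I0 : 0 <= I by rewrite fine_ge0// integral_ge0// => x _; rewrite lee_fin.
have gT : 0 < gam * T by rewrite mulr_gt0.
have I5 : gam * T * I <= 2 * Z.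
  have e1 : gam * I * T <= (C * (q * SG) + M) * T.
    apply: ler_wpM2r; first exact: ltW.
    by apply: le_trans I3 _; rewrite lerD2r ler_wpM2l.
  have e2 : C * q * (T * SG) <= C * q * (q ^+ j1 * m + q * (C2 * I)).
    apply: ler_wpM2l; first by rewrite mulr_ge0// ltW.
    by apply: le_trans I4 _; rewrite lerD2l ler_wpM2l// ltW.
  have e3 : 2 * (C * q * (q * C2)) * I <= gam * T * I by rewrite ler_wpM2r.
  by rewrite /Z; lra.
have I6 : q ^+ (j1 + N) * v N <= C2 * (2 * Z / (gam * T)).
  apply: (@le_trans _ _ S).
    rewrite /S big_ord_recr/= lerDr; apply: sumr_ge0 => i _.
    by rewrite mulr_ge0// ltW.
  apply: le_trans I2 _; rewrite ler_wpM2l ?stair_cst_ge0//.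
  by rewrite ler_pdivlMr// mulrC.
rewrite vE lee_fin scale_powR1//.
by rewrite ler_pdivlMr// mulrC.
Qed.

End density.

(** * Hausdorff null sets *)

Section hausdorff.
Context {R : realType} {d : nat}.
Local Notation V := 'rV[R]_d.
Variable nu : {measure set (borel R d) -> \bar R}.

(** Spares measurability arguments for sets defined by density conditions. *)
Lemma small_cover_negligible (A : set (borel R d)) :
  (forall e : R, 0 < e -> exists Z : set (borel R d),
    [/\ measurable Z, A `<=` Z & (nu Z <= e%:E)%E]) -> nu.-negligible A.
Proof.
move=> H; have Hn n : exists Z : set (borel R d),
    [/\ measurable Z, A `<=` Z & (nu Z <= (n.+1%:R^-1)%:E)%E].
  by apply: H; rewrite invr_gt0.
pose Z n := sval (cid (Hn n)); have HZ n := svalP (cid (Hn n)).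
have mZ : measurable (\bigcap_n Z n).
  by apply: bigcapT_measurable => n; have [] := HZ n.
exists (\bigcap_n Z n); split => //; last first.
  by move=> x Ax n _; have [_ AZ _] := HZ n; exact: AZ.
apply/eqP; rewrite eq_le measure_ge0 andbT; apply/lee_addgt0Pr => e e0.
rewrite add0e; have [n ne] : exists n, (n.+1%:R^-1 : R) < e.
  exists (Num.truncn e^-1); rewrite -[ltRHS]invrK ltf_pV2 ?posrE ?invr_gt0//.
  exact: truncnS_gt.
apply: (@le_trans _ _ (nu (Z n))).
  have [mZn _ _] := HZ n; apply: le_measure; [exact: mem_set|exact: mem_set|].
  by move=> x; apply.
by have [_ _ /le_trans] := HZ n; apply; rewrite lee_fin ltW.
Qed.

Lemma scale_small (t : R) : 0 < t -> exists n, scale R n < t.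
Proof.
move=> t0; exists (Num.truncn t^-1).+1.
rewrite /scale exprVn -[ltRHS]invrK ltf_pV2 ?posrE ?invr_gt0 ?exprn_gt0//.
apply: lt_trans (truncnS_gt _) _.
by rewrite -natrX ltr_nat ltn_expl.
Qed.

Lemma diam_ge (A : set V) x y : A x -> A y -> ((enorm (x - y))%:E <= diam A)%E.
Proof. by move=> Ax Ay; apply: ereal_sup_ubound; exists x => //; exists y. Qed.

Lemma enorm_norm (v : V) : `|v| <= enorm v.
Proof.
rewrite {1}/Num.Def.normr/= mx_normrE; apply/bigmax_leP; split; first exact: sqrtr_ge0.
by move=> [i j] _ /=; rewrite (ord1 i); exact: enorm_coord_le.
Qed.

Variables (kappa kappa' L : R) (j1 : nat).
Hypotheses (kappa_ge0 : 0 <= kappa) (kk : kappa <= kappa') (k'0 : 0 < kappa') (L0 : 0 <= L).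

(** Replaces a set of diameter [dk] by a cube of a scale comparable with [dk].
    Diameter 0 is the reason for the error [e]: no scale is comparable with it. *)
Lemma scale_choice (dk e : R) : 0 <= dk -> dk < scale R j1 -> 0 < e ->
  exists N, dk <= scale R (j1 + N) /\
    L * scale R (j1 + N) `^ kappa' <= L * 3 `^ kappa * dk `^ kappa + e.
Proof.
move=> dk0 dkj e0.
have s0 j : 0 < scale R j := scale_gt0 j.
have [->|dkn] := eqVneq dk 0.
  have L1 : 0 < L + 1 by rewrite ltr_wpDl.
  pose t := (e / (L + 1)) `^ kappa'^-1.
  have eL : 0 < e / (L + 1) by rewrite divr_gt0.
  have t0 : 0 < t by rewrite powR_gt0.
  have [n nt] := scale_small t0.
  exists n; split; first exact: ltW.
  have st : scale R (j1 + n) <= t.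
    apply: le_trans (ltW nt); rewrite /scale exprD ler_piMl ?exprn_ge0//.
    by rewrite exprn_ile1// invf_le1//; lra.
  apply: ler_wpDl.
    by rewrite !mulr_ge0 ?powR_ge0.
  have h : scale R (j1 + n) `^ kappa' <= e / (L + 1).
    have -> : e / (L + 1) = t `^ kappa'.
      by rewrite /t -powRrM mulVf ?powRr1 ?ltW// gt_eqF.
    by apply: ge0_ler_powR; rewrite ?nnegrE ?(ltW k'0) ?(ltW (s0 _)) ?(ltW t0).
  apply: le_trans (ler_wpM2l L0 h) _.
  rewrite mulrCA ler_piMr ?(ltW e0)// ler_pdivrMr//; lra.
have dkgt : 0 < dk by rewrite lt_neqAle eq_sym dkn.
have ex : exists n, scale R (j1 + n) < dk.
  have [n nt] := scale_small dkgt; exists n; apply: le_lt_trans nt.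
  rewrite /scale exprD ler_piMl ?exprn_ge0//.
  by rewrite exprn_ile1// invf_le1//; lra.
case: (ex_minnP ex) => -[|N] HN minN.
  by move: HN; rewrite addn0 ltNge (ltW dkj).
have dkN : dk <= scale R (j1 + N).
  rewrite leNgt; apply/negP => /minN; by rewrite ltnn.
exists N; split => //.
have s3 : scale R (j1 + N) <= 3 * dk.
  by rewrite -scaleS -addnS ler_pM2l// ltW.
have s1 : scale R (j1 + N) <= 1.
  by rewrite /scale exprn_ile1// invf_le1//; lra.
apply: ler_wpDr; first exact: ltW.
rewrite -mulrA ler_wpM2l// -powRM// ?(ltW dkgt)//.
apply: (@le_trans _ _ (scale R (j1 + N) `^ kappa)).
  by apply: ger_powR => //; rewrite s0 s1.
by apply: ge0_ler_powR; rewrite ?nnegrE ?(ltW (s0 _)) ?mulr_ge0 ?(ltW dkgt).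
Qed.

(** The mass distribution principle: every set of a covering that meets [A] lies in
    a cube centred in [A] of comparable size. *)
Lemma hausdorff_null_cover (A B : set (borel R d)) :
  A `<=` B -> hausdorff kappa B = 0%E ->
  (forall x, A x -> forall N,
     (nu (cube x (scale R (j1 + N))) <= (L * scale R (j1 + N) `^ kappa')%:E)%E) ->
  nu.-negligible A.
Proof.
move=> AB HB HA; apply: small_cover_negligible => e e0.
have s0 j : 0 < scale R j := scale_gt0 j.
pose L3 : R := L * 3 `^ kappa.
have L30 : 0 <= L3 by rewrite mulr_ge0 ?powR_ge0.
pose eta : R := e / 2 / (L3 + 1).
have L31 : 0 < L3 + 1 by lra.
have eta0 : 0 < eta by rewrite !divr_gt0.
pose delta : R := scale R j1 / 2.
have delta0 : 0 < delta by rewrite divr_gt0.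
have [y [C [BC Cd] <-] Clt] : exists2 y, [set (\sum_(0 <= k <oo) hausdorff_gauge kappa (C k))%E | C in
    [set C : nat -> set V | B `<=` \bigcup_k C k /\ forall k, (diam (C k) <= delta%:E)%E]] y &
    (y < eta%:E)%E.
  apply: ereal_inf_lt; apply: (@le_lt_trans _ _ 0%E); last by rewrite lte_fin.
  by rewrite -[leRHS]HB; apply: ereal_sup_ubound; exists delta.
pose ek (k : nat) : R := e / 2 / (2 ^ k.+1)%:R.
have ek0 k : 0 < ek k by rewrite !divr_gt0// ltr0n expn_gt0.
have g0 k : (0 <= hausdorff_gauge kappa (C k))%E.
  by rewrite /hausdorff_gauge; case: ifP => // _; exact: poweR_ge0.
have Hk k : exists Z : set (borel R d), [/\ measurable Z, A `&` C k `<=` Z &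
   (nu Z <= L3%:E * hausdorff_gauge kappa (C k) + (ek k)%:E)%E].
  have [AC0|/set0P[x [Ax Cx]]] := eqVneq (A `&` C k) set0.
    exists set0; split => //; first by rewrite AC0.
    by rewrite measure0 adde_ge0 ?lee_fin ?(ltW (ek0 k))// mule_ge0.
  have dge : (0 <= diam (C k))%E.
    by apply: le_trans (diam_ge Cx Cx); rewrite lee_fin sqrtr_ge0.
  have dfin : diam (C k) \is a fin_num.
    by rewrite ge0_fin_numE//; apply: le_lt_trans (Cd k) _; rewrite ltry.
  pose dk := fine (diam (C k)).
  have dkE : diam (C k) = dk%:E by rewrite /dk fineK.
  have dk0 : 0 <= dk by rewrite fine_ge0.
  have dks : dk < scale R j1.
    have := Cd k; rewrite dkE lee_fin => /le_lt_trans; apply.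
    by rewrite /delta ltr_pdivrMr// ltr_pMr//; lra.
  have [N [dN LN]] := scale_choice dk0 dks (ek0 k).
  exists (cube x (scale R (j1 + N))); split.
  - exact: measurable_cube.
  - move=> z [_ Cz]; rewrite /cube/=; apply: le_trans dN.
    apply: le_trans (enorm_norm _) _.
    by rewrite -lee_fin -dkE; exact: diam_ge.
  - apply: le_trans (HA x Ax N) _.
    rewrite /hausdorff_gauge ifF; last by apply/negbTE/set0P; exists x.
    by rewrite dkE poweR_EFin -EFinM -EFinD lee_fin.
pose Z k := sval (cid (Hk k)); have HZ k := svalP (cid (Hk k)).
have mZ k : measurable (Z k) by have [] := HZ k.
exists (\bigcup_k Z k); split.
- exact: bigcupT_measurable.
- move=> x Ax; have [k _ Ckx] := BC x (AB x Ax).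
  by exists k => //; have [_ AZ _] := HZ k; exact: AZ.
apply: le_trans (measure_sigma_subadditive nu mZ (bigcupT_measurable _ mZ) (@subset_refl _ _)) _.
apply: (@le_trans _ _ (\sum_(0 <= k <oo) (L3%:E * hausdorff_gauge kappa (C k) + (ek k)%:E))%E).
  by apply: lee_nneseries => // k _; have [] := HZ k.
apply: le_trans (epsilon_trick _ _ _) _.
- by move=> k; rewrite mule_ge0.
- by rewrite divr_ge0// ltW.
rewrite nneseriesZl//.
apply: (@le_trans _ _ (L3%:E * eta%:E + (e / 2)%:E)%E).
  by rewrite leeD2r// lee_wpmul2l ?lee_fin// ltW.
rewrite -EFinM -EFinD lee_fin /eta.
have : L3 * (e / 2 / (L3 + 1)) <= e / 2.
  by rewrite mulrCA ler_piMr ?divr_ge0 ?(ltW e0)// ler_pdivrMr//; lra.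
lra.
Qed.

End hausdorff.

(** * The total variation measure *)

Section total_variation.
Context {R : realType} {d m : nat}.
Local Notation V := 'rV[R]_d.
Variables (Omega : set V) (mu : radon m Omega) (nu : {measure set (borel R d) -> \bar R}).
Hypotheses (Hnu : is_total_variation mu nu).

Lemma tv_le_open (B : set (borel R d)) (U : set V) : measurable B -> open U ->
  B `&` Omega `<=` U -> U `<=` Omega -> (nu B <= tv_open mu U)%E.
Proof. by move=> mB oU BU UO; rewrite Hnu//; apply: ereal_inf_lbound; exists U. Qed.

(** A positive margin [r - r'] is needed as the total variation is defined by open
    sets. *)
Lemma nu_cube_fin (c : V) (r r' : R) : r' < r -> cube c r `<=` Omega ->
  (nu (cube c r') < +oo)%E.
Proof.
move=> rr' rO; have [C HC] := pairing_bounded mu (@compact_cube _ _ c r) rO.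
have BQ : ball c r `<=` cube c r by move=> x; rewrite -ball_normE => /ltW.
apply: (@le_lt_trans _ _ (tv_open mu (ball c r))).
  apply: tv_le_open; [exact: measurable_cube|exact: ball_open| |exact: subset_trans rO].
  by move=> x [xr _]; rewrite -ball_normE /=; exact: le_lt_trans xr rr'.
apply: (@le_lt_trans _ _ (C * 1)%:E); last by rewrite ltry.
apply: ub_ereal_sup => _ [phi [[cphi kphi sphi] phi1] <-].
rewrite lee_fin; apply: le_trans (ler_norm _) _; apply: HC => //.
  by split => //; apply: subset_trans rO; exact: subset_trans sphi BQ.
move=> x nx; apply/eqP; apply: contra_notT nx => phix.
by apply/BQ/sphi/subset_closure.
Qed.

Lemma outer_regular (B : set (borel R d)) (e : R) : measurable B -> B `<=` Omega ->
  (nu B < +oo)%E -> 0 < e ->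
  exists U : set V, [/\ open U, B `<=` U, U `<=` Omega & (nu (U `\` B) <= e%:E)%E].
Proof.
move=> mB BO Bfin e0.
have Bf : nu B \is a fin_num by rewrite ge0_fin_numE ?measure_ge0.
have [y [U [oU BU UO] <-] Ulim] : exists2 y, [set tv_open mu U | U in
    [set U | [/\ open U, B `&` Omega `<=` U & U `<=` Omega]]] y & (y < nu B + e%:E)%E.
  by apply: ereal_inf_lt; rewrite -[X in (X < _)%E]/(tv mu (B `&` Omega)) -Hnu// lteDl.
have BU' : B `<=` U by move=> x Bx; apply: BU; split => //; exact: BO.
exists U; split => //.
have mU : measurable (U : set (borel R d)) by exact: borel_open.
have nuU : (nu U <= nu B + e%:E)%E.
  by apply: le_trans (ltW Ulim); apply: tv_le_open => // x [].
have -> : nu (U `\` B) = (nu U - nu B)%E.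
  rewrite measureD//; last first.
    by apply: le_lt_trans nuU _; rewrite -(fineK Bf) -EFinD ltry.
  by congr (_ - nu _)%E; apply: setIidr.
by rewrite leeBlDr// addeC.
Qed.

End total_variation.

(** * The wave cone *)

Section wave_cone.
Context {R : realType} {d m n : nat}.
Local Notation V := 'rV[R]_d.
Variables (Omega : set V) (P : 'I_d -> 'M[R]_(m, n)) (sigma : borel R d -> borel R m).
Implicit Types (v : 'rV[R]_m).

Lemma symbol_row v (xi : V) :
  v *m symbol P xi = xi *m \matrix_(i, k) (v *m P i) 0 k.
Proof.
apply/rowP => k; rewrite /symbol mulmx_sumr summxE !mxE; apply: eq_bigr => i _.
by rewrite -scalemxAr !mxE; congr (_ * _); apply: eq_bigr => l _.
Qed.

(** A vector outside the cone has [M v] of independent rows, hence a right inverse,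
    which may be perturbed to a rational matrix. *)
Lemma notin_cone_approx v (e : R) : 0 < e -> ~ wave_cone P v ->
  exists Wq : 'M[rat]_(n, d),
    forall i j, `|symbol_mx P (map_mx ratr Wq) v i j - (i == j)%:R| <= e.
Proof.
move=> e0 vP; pose M := \matrix_(i, k) (v *m P i) 0 k.
have : row_free M.
  rewrite -kermx_eq0; apply: contra_notT vP; rewrite -nz_row_eq0 => xi0.
  exists (nz_row (kermx M)) => //=.
  by rewrite symbol_row; apply/sub_kermxP; exact: nz_row_sub.
move=> /row_freeP[W MW].
pose S : R := 1 + \sum_i \sum_k `|M i k|.
have S0' : 0 <= \sum_i \sum_k `|M i k| by apply: sumr_ge0 => i _; apply: sumr_ge0.
have S0 : 0 < S by rewrite ltr_pwDl.
pose eta := e / S; have eta0 : 0 < eta by rewrite divr_gt0.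
have Hq k j : exists q : rat, `|ratr q - W k j| <= eta.
  have [q] := @rat_in_itvoo R (W k j - eta) (W k j + eta) ltac:(lra).
  by rewrite in_itv/= => /andP[h1 h2]; exists q; rewrite ler_norml; lra.
exists (\matrix_(k, j) sval (cid (Hq k j))) => i j.
have -> : (i == j)%:R = (M *m W) i j by rewrite MW mxE.
have -> : symbol_mx P (map_mx ratr (\matrix_(k, j) sval (cid (Hq k j)))) v i j - (M *m W) i j
  = \sum_k M i k * (ratr (sval (cid (Hq k j))) - W k j).
  rewrite !mxE -sumrB; apply: eq_bigr => k _.
  by rewrite !mxE mulrBr.
apply: le_trans (ler_norm_sum _ _ _) _.
apply: (@le_trans _ _ ((\sum_k `|M i k|) * eta)).
  rewrite mulr_suml; apply: ler_sum => k _; rewrite normrM ler_wpM2l//.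
  exact: svalP (cid (Hq k j)).
rewrite /eta mulrCA ler_piMr ?(ltW e0)// ler_pdivrMr// mul1r /S (bigD1 i)//=.
have : 0 <= \sum_(i0 | i0 != i) \sum_k `|M i0 k|.
  by apply: sumr_ge0 => i0 _; apply: sumr_ge0.
lra.
Qed.

(** If [xi *m M v = 0], then [xi = - xi (M v W - 1)], which is smaller than [xi]. *)
Lemma approx_notin_cone v (e : R) (W : 'M[R]_(n, d)) : d%:R * e < 1 ->
  (forall i j, `|symbol_mx P W v i j - (i == j)%:R| <= e) -> ~ wave_cone P v.
Proof.
move=> de HW [xi /= xi0 vxi].
have E0 j : \sum_i xi 0 i * symbol_mx P W v i j = 0.
  have : (v *m symbol P xi *m W) 0 j = 0 by rewrite vxi mul0mx mxE.
  rewrite /symbol mulmx_sumr mulmx_suml summxE => E; rewrite -[RHS]E.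
  by apply: eq_bigr => i _; rewrite -scalemxAr -scalemxAl !mxE.
have [j Hj] : exists j, `|xi| = `|xi 0 j|.
  have := mx_norm_neq0 (_ : mx_norm xi != 0).
  have xin : mx_norm xi != 0 by rewrite -[mx_norm xi]/(`|xi|) normr_eq0.
  by move=> /(_ xin)[[i j] /= H]; exists j; rewrite [LHS]H (ord1 i).
have Hi i : `|xi 0 i| <= `|xi|.
  rewrite {2}/Num.Def.normr/= mx_normrE.
  exact: (le_bigmax _ (fun ij : 'I_1 * 'I_d => `|xi ij.1 ij.2|) (0, i)).
have x0 : 0 < `|xi| by rewrite normr_gt0.
have e2 : `|xi 0 j| <= d%:R * (`|xi| * e).
  have -> : xi 0 j = - \sum_i xi 0 i * (symbol_mx P W v i j - (i == j)%:R).
    under eq_bigr do rewrite mulrBr.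
    rewrite sumrB E0 sub0r opprK (bigD1 j)//= eqxx mulr1 big1 ?addr0// => i ij.
    by rewrite (negbTE ij) mulr0.
  by rewrite normrN; apply: norm_sum_le => i; rewrite normrM ler_pM.
move: e2; rewrite -Hj leNgt => /negP; apply.
by rewrite mulrCA -[ltRHS]mulr1 ltr_pM2l.
Qed.

End wave_cone.

(** * Countable decomposition and conclusion *)

Section assembly.
Context {R : realType} {d m n : nat}.
Local Notation V := 'rV[R]_d.
Variables (Omega : set V) (P0 : 'M[R]_(m, n)) (P : 'I_d -> 'M[R]_(m, n)).
Variables (mu : radon m Omega) (nu : {measure set (borel R d) -> \bar R}).
Variable sigma : borel R d -> borel R m.
Hypotheses (oO : open Omega) (Hsol : solves P0 P mu).
Hypotheses (Hnu : is_total_variation mu nu) (Hpol : is_polar mu nu sigma).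
Variables (kappa kap : R).
Hypotheses (kappa_ge0 : 0 <= kappa) (kk : kappa <= kap) (kap0 : 0 < kap) (kapd : kap < d%:R).

Local Notation good W := (nearly_inverted Omega P sigma W (inversion_tol d kap)).

(** By [outer_regular], the set has a neighbourhood that exceeds it by little; this
    excess is the set [D] of [weak_density].  Outside a small set every point then
    satisfies [density_bound]; sorting these points by the constant and the first
    scale gives sets to which [hausdorff_null_cover] applies. *)
Lemma nearly_inverted_negligible (W : 'M[R]_(n, d)) (p : V) (r : R) (B : set (borel R d)) :
  0 < r -> cube p (3 * r) `<=` Omega -> hausdorff kappa B = 0%E ->
  nu.-negligible (B `&` (good W `&` cube p r)).
Proof.
move=> r0 pO HB; pose F : set (borel R d) := good W `&` cube p r; rewrite -/F.
have mG : measurable (good W) := measurable_nearly_inverted P oO Hpol W _.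
have mF : measurable F by apply: measurableI => //; exact: measurable_cube.
have [C C0 HE] := energy_bound oO Hsol Hpol kap0 kapd W.
pose gam : R := (d%:R - kap) / 4.
have gam0 : 0 < gam by rewrite divr_gt0// subr_gt0.
pose q := growth kap; pose C2 := stair_cst d kap.
have q1 : 1 < q := growth_gt1 kap0.
have q0 : 0 <= q by apply: ltW; exact: lt_trans q1.
have C20 : 0 <= C2 := stair_cst_ge0 kap0.
pose T : R := 2 * (C * q * (q * C2)) / gam + 1.
have T0 : 0 < T.
  apply: ltr_wpDl; last exact: ltr01.
  apply: divr_ge0; last exact: ltW.
  by apply: mulr_ge0 => //; apply: mulr_ge0; apply: mulr_ge0.
have TE : 2 * (C * q * (q * C2)) <= gam * T.
  by rewrite /T mulrDr mulr1 [X in _ <= X + _]mulrC divfK ?gt_eqF// lerDl ltW.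
(* one index serves as the constant and as the first scale, since the bound weakens when either grows *)
pose AM k : set (borel R d) := [set x | (B `&` F) x /\ forall N,
  (nu (cube x (scale R (k + N))) <= (k%:R * scale R (k + N) `^ kap)%:E)%E].
have negAM : nu.-negligible (\bigcup_k AM k).
  apply: negligible_bigcup => k.
  apply: (@hausdorff_null_cover R d nu kappa kap k%:R k _ _ _ _ _ B) => //.
  - by move=> x [[]].
  - by move=> x [_].
suff negR : nu.-negligible ((B `&` F) `\` \bigcup_k AM k).
  apply: negligibleS (negligibleU negR negAM).
  by move=> x BFx; have [|] := pselect ((\bigcup_k AM k) x); [right|left].
apply: small_cover_negligible => e e0.
have fin2 : (nu (cube p (2 * r)) < +oo)%E.
  by apply: (nu_cube_fin Hnu _ pO); rewrite ltr_pM2r// ltr_nat.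
have Ffin : (nu F < +oo)%E.
  apply: le_lt_trans fin2; apply: le_measure; rewrite ?inE//; first exact: measurable_cube.
  by apply: subIset; right; apply: cubeS; rewrite ler_peMl ?(ltW r0)// ler1n.
have FO : F `<=` Omega by move=> x [[]].
have eT : 0 < e / T by rewrite divr_gt0.
have [U [oU FU UO nuU]] := outer_regular Hnu mF FO Ffin eT.
have mD : measurable (U `\` F : set (borel R d)).
  by apply: measurableD => //; exact: borel_open.
have [Z [mZ nZ HZ]] := weak_density nu 0 (@compact_cube _ _ p r) mD (ltW T0) (@scale_gt0 R).
exists Z; split => //; last first.
  apply: le_trans nZ _; apply: (@le_trans _ _ (T%:E * (e / T)%:E)%E).
    by rewrite lee_wpmul2l ?lee_fin// ltW.
  by rewrite -EFinM mulrCA mulfV ?mulr1// gt_eqF.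
move=> x [[Bx Fx] nAMx]; apply: contrapT => nZx; apply: nAMx.
have Hx := HZ x Fx.2 nZx.
have [rho0 rho00 rhoU] : exists2 e0 : R, 0 < e0 & ball x e0 `<=` U.
  by apply/nbhs_ballP; exact: open_nbhs_nbhs (conj oU (FU _ Fx)).
pose rho : R := Num.min (rho0 / 2) r.
have rhogt : 0 < rho by rewrite lt_min r0 divr_gt0.
have cU : cube x rho `<=` U.
  apply: subset_trans rhoU => y; rewrite -ball_normE /= => xy.
  apply: le_lt_trans xy _; rewrite gt_min ltr_pdivrMr//.
  by rewrite ltr_pMr// ltr1n.
have cfin : (nu (cube x rho) < +oo)%E.
  apply: le_lt_trans fin2; apply: le_measure; [by apply: mem_set; exact: measurable_cube..|].
  move=> y xy; rewrite /cube/= -(subrKA x); apply: le_trans (ler_normD _ _) _.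
  rewrite mulr_natl mulr2n lerD//; first exact: Fx.2.
  by apply: le_trans xy _; rewrite ge_min lexx orbT.
have [s1 /andP[s10 s1rho] Hs1] := HE x rho rhogt (subset_trans cU UO) cfin.
have s13 : 0 < s1 / 3 by rewrite divr_gt0.
have [j1 j1s] := scale_small s13.
have j1s3 : 3 * scale R j1 <= s1 by rewrite mulrC -ler_pdivlMr// ltW.
have j1s1 : 0 < scale R j1 <= s1.
  by rewrite scale_gt0/=; apply: le_trans j1s3; rewrite ler_peMl ?ler1n// ltW// scale_gt0.
have [M M0 HM] := Hs1 _ j1s1.
have [j jj1||L L0 HL] := @density_bound R d kap kap0 nu x j1 (good W) gam C T M
    mG gam0 C0 T0 M0 TE HM.
- apply: le_trans (ltW (Hx j isT)).
  rewrite lee_wpmul2l ?lee_fin ?(ltW T0)//; apply: le_measure.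
  + by apply: mem_set; apply: measurableD => //; exact: measurable_cube.
  + by apply: mem_set; apply: measurableI => //; exact: measurable_cube.
  move=> y [xy nGy]; split => //; split; last by move=> [].
  apply: cU; apply: cubeS xy; apply: le_trans s1rho.
  apply: (@le_trans _ _ (scale R j1)); last by move/andP : j1s1 => [].
  by rewrite /scale -(subnK jj1) exprD ler_piMl ?exprn_ge0// exprn_ile1// invf_le1// ler1n.
- apply: le_lt_trans cfin; apply: le_measure; [by apply: mem_set; exact: measurable_cube..|].
  by apply: cubeS; exact: le_trans s1rho.
pose k := maxn j1 (Num.truncn L).+1.
exists k => //; split => // N.
have -> : (k + N = j1 + (k - j1 + N))%N by rewrite addnA subnKC// leq_maxl.
apply: le_trans (HL _) _; rewrite lee_fin ler_wpM2r ?powR_ge0//.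
by apply: le_trans (ltW (truncnS_gt L)) _; rewrite ler_nat leq_maxr.
Qed.

(** This makes [nearly_inverted] a part of the set where the polar is outside the
    cone, whence the measurability of the latter. *)
Lemma inversion_tol_lt1 : d%:R * inversion_tol d kap < 1.
Proof.
have d0 : 0 < d%:R :> R := lt_trans kap0 kapd.
have d1 : 1 <= d%:R :> R by rewrite ler1n -(@ltr0n R).
have h0 : 0 < d%:R * (2 + kap) by rewrite mulr_gt0// addr_gt0.
rewrite -(ltr_pM2r h0) mul1r.
have -> : d%:R * inversion_tol d kap * (d%:R * (2 + kap)) = d%:R ^+ 2 * (2 + kap) * inversion_tol d kap by ring.
rewrite inversion_tolE//; have := kap0; have := mulr_gt0 d0 kap0.
lra.
Qed.

Lemma inversion_tol_gt0 : 0 < inversion_tol d kap.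
Proof.
have d0 : 0 < d%:R :> R := lt_trans kap0 kapd.
by rewrite divr_gt0 ?subr_gt0// !mulr_gt0// ?exprn_gt0// addr_gt0.
Qed.

Definition elliptic_part : set (borel R d) := [set x | Omega x /\ ~ wave_cone P (sigma x)].

Definition rat_inverted (k : nat) : set (borel R d) :=
  if @unpickle 'M[rat]_(n, d) k is Some Wq then good (map_mx ratr Wq) else set0.

Lemma elliptic_partE : elliptic_part = \bigcup_k rat_inverted k.
Proof.
apply/seteqP; split => [x [Ox /(notin_cone_approx inversion_tol_gt0)[Wq HW]]|x [k _]].
  by exists (pickle Wq) => //; rewrite /rat_inverted pickleK.
rewrite /rat_inverted; case: unpickle => // Wq [Ox HW]; split => //.
exact: approx_notin_cone inversion_tol_lt1 HW.
Qed.

Lemma measurable_elliptic_part : measurable elliptic_part.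
Proof.
rewrite elliptic_partE; apply: bigcupT_measurable => k; rewrite /rat_inverted.
by case: unpickle => // Wq; exact: (measurable_nearly_inverted P oO Hpol).
Qed.

Lemma rat_cube (x : V) : Omega x -> exists (pq : 'rV[rat]_d) (i : nat),
  cube (map_mx ratr pq) (3 * (i.+1%:R^-1 : R)) `<=` Omega /\
  cube (map_mx ratr pq) (i.+1%:R^-1 : R) x.
Proof.
move=> Ox; have [e e0 eO] : exists2 e : R, 0 < e & ball x e `<=` Omega.
  by apply/nbhs_ballP; exact: open_nbhs_nbhs.
pose i := Num.truncn (4 / e); pose r : R := i.+1%:R^-1.
have r0 : 0 < r by rewrite invr_gt0.
have re : 4 * r < e.
  by rewrite ltr_pdivrMr// mulrC -ltr_pdivrMr// truncnS_gt.
have Hq j : exists q : rat, `|ratr q - x 0 j| <= r.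
  have [q] := @rat_in_itvoo R (x 0 j - r) (x 0 j + r) ltac:(lra).
  by rewrite in_itv/= => /andP[h1 h2]; exists q; rewrite ler_norml; lra.
exists (\row_j sval (cid (Hq j))), i; set p := map_mx _ _.
have xp : cube p r x.
  apply/cube_coord; first exact: ltW.
  by move=> j; rewrite !mxE distrC; exact: svalP (cid (Hq j)).
split => // y py; apply: eO; rewrite -ball_normE /=.
rewrite -(subrKA p); apply: le_lt_trans (ler_normD _ _) _; apply: le_lt_trans re.
have h1 : `|p - x| <= r := xp.
have h2 : `|p - y| <= 3 * r := py.
rewrite (distrC x); lra.
Qed.

Lemma elliptic_part_negligible (B : set (borel R d)) : hausdorff kappa B = 0%E ->
  nu.-negligible (B `&` elliptic_part).
Proof.
move=> HB.
pose piece (k : nat) : set (borel R d) :=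
  if @unpickle ('M[rat]_(n, d) * ('rV[rat]_d * nat))%type k is Some (Wq, (pq, i)) then
    if `[< cube (map_mx ratr pq) (3 * (i.+1%:R^-1 : R)) `<=` Omega >] then
      B `&` (good (map_mx ratr Wq) `&` cube (map_mx ratr pq) (i.+1%:R^-1 : R))
    else set0
  else set0.
apply: (@negligibleS _ _ _ _ (\bigcup_k piece k)); last first.
  apply: negligible_bigcup => k; rewrite /piece.
  case: unpickle => [[Wq [pq i]]|]; last exact: negligible_set0.
  case: ifPn => [/asboolP pO|_]; last exact: negligible_set0.
  by apply: nearly_inverted_negligible => //; rewrite invr_gt0.
move=> x [Bx]; rewrite elliptic_partE => -[k _]; rewrite /rat_inverted.
case: unpickle => // Wq Gx.
have [pq [i [pO px]]] := rat_cube Gx.1.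
exists (pickle (Wq, (pq, i))) => //; rewrite /piece pickleK ifT//.
exact/asboolP.
Qed.

End assembly.

Theorem corollary3 (R : realType) (d m n : nat) (Omega : set 'rV[R]_d)
    (P0 : 'M[R]_(m, n)) (P : 'I_d -> 'M[R]_(m, n)) (mu : radon m Omega)
    (nu : {measure set (borel R d) -> \bar R})
    (sigma : borel R d -> borel R m) :
  open Omega ->
  solves P0 P mu ->
  is_total_variation mu nu ->
  is_polar mu nu sigma ->
  forall kappa : R, 0 <= kappa -> kappa < d%:R ->
    (fun A : set (borel R d) =>
       nu (A `&` [set x | Omega x /\ ~ wave_cone P (sigma x)]))
      `<< @hausdorff R d kappa.
Proof.
move=> oO Hsol Hnu Hpol kappa k0 kd N HN A mA AN.
(* a positive exponent, even for kappa = 0, which the density bound requires *)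
pose kap := (kappa + d%:R) / 2.
have [kk kap0 kapd] : [/\ kappa <= kap, 0 < kap & kap < d%:R].
  by rewrite /kap; split; lra.
apply: measure_negligible.
  by apply: measurableI => //; exact: (measurable_elliptic_part P oO Hpol kap0 kapd).
exact: (elliptic_part_negligible oO Hsol Hnu Hpol k0 kk kap0 kapd (HN A mA AN)).
Qed.
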